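(* Let $\pi:X\to S$ be a smooth morphism and let $(\mathscr{A}_S,\{\cdot,\cdot\}_S)$ be a family of Lie algebroids over $\pi$. Then $\pi_*\mathfrak{u}(\mathscr{A}_S)$ has the structure of a Lie algebroid over $S$.
   Context: Everything is over $\mathbb{C}$, in the holomorphic setting. $T_X$ is the tangent sheaf, $T_{X|S}\subseteq T_X$ the relative tangent sheaf of $\pi$, and $0\to T_{X|S}\to T_X\to\pi^*T_S\to0$ is exact. $\pi^{-1}T_S\subset\pi^*T_S$ is the sheaf-theoretic inverse image. Lie algebroid on $X$: a reflexive sheaf $\mathscr{A}$ of $\mathcal{O}_X$-modules with an $\mathcal{O}_X$-morphism $a:\mathscr{A}\to T_X$ (anchor) and a $\mathbb{C}$-bilinear bracket $\{\cdot,\cdot\}$ which is antisymmetric, satisfies the Jacobi identity, and satisfies $\{gu,v\}=g\{u,v\}-a(v)(g)u$ for $g\in\mathcal{O}_X$, $u,v\in\mathscr{A}$. Family of Lie algebroids over $\pi:X\to S$: a reflexive sheaf $\mathscr{A}_S$ of $\mathcal{O}_X$-modules, flat over $S$, with an $\mathcal{O}_X$-morphism $a_S:\mathscr{A}_S\to T_{X|S}$ and a $\pi^{-1}\mathcal{O}_S$-bilinear bracket $\{\cdot,\cdot\}_S$ satisfying the same three axioms (with $a_S$ in place of $a$). Differential operators: a differential operator of order $\le1$ on $\mathscr{A}_S$ is a $\mathbb{C}$-linear morphism $\psi:\mathscr{A}_S\to\mathscr{A}_S$ such that for each local section $g$ of $\mathcal{O}_X$ there is a local section $\psi g$ of $\mathcal{O}_X$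 with $\psi\circ m_g-m_g\circ\psi=m_{\psi g}$ ($m_h$ is multiplication by $h$). $D^{\le1}_X(\mathscr{A}_S)$ is the sheaf of these; the symbol $\sigma(\psi)\in T_X$ is the derivation $g\mapsto\psi g$. $\mathrm{Der}_{\mathrm{Lie}}(\mathscr{A}_S)$ is the sheaf of derivations of the Lie algebra structure of $\mathscr{A}_S$; the intersection $\mathrm{Der}_{\mathrm{Lie}}(\mathscr{A}_S)\cap D^{\le1}_X(\mathscr{A}_S)$ is taken inside the $\mathbb{C}$-linear endomorphisms of $\mathscr{A}_S$. The map $\alpha\mapsto\{\alpha,-\}_S$ sends $\mathscr{A}_S$ to this intersection, with $\sigma(\{\alpha,-\}_S)=a_S(\alpha)$, so $\sigma$ induces a map $$\sigma:\big(\mathrm{Der}_{\mathrm{Lie}}(\mathscr{A}_S)\cap D^{\le1}_X(\mathscr{A}_S)\big)/\mathscr{A}_S\to T_X/T_{X|S}=\pi^*T_S,$$ (the quotient being by the image of $\mathscr{A}_S$), and $$\mathfrak{u}(\mathscr{A}_S):=\sigma^{-1}(\pi^{-1}T_S),$$ a sheaf of $\pi^{-1}\mathcal{O}_S$-modules with the Lie bracket induced by the commutator of operators. Write $a_{\mathfrak{u}}:\mathfrak{u}(\mathscr{A}_S)\to\pi^{-1}T_S$ for the restriction of $\sigma$. The structure meant on $\pi_*\mathfrak{u}(\mathscr{A}_S)$ is: the $\mathcal{O}_S$-module structure and bracket pushed forward from $\mathfrak{u}(\mathscr{A}_S)$, and the anchor $\pi_*a_{\mathfrak{u}}:\pi_*\mathfrak{u}(\mathscr{A}_S)\to\pi_*\pi^{-1}T_S\cong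 T_S$ (the paper uses this identification, which it justifies for $\pi$ proper).
   Formalization: Reflexivity of π_*u(A_S) is not claimed: it fails for sl_2⊗O on C with bracket z[,] and zero anchor (torsion). Assumed: T_S → π_*π^{-1}T_S is an isomorphism (needed to define the anchor), and no nonzero local function annihilates A_S (symbol well defined). *)

(* Defs.v *)
From HB Require Import structures.
From mathcomp Require Export all_boot all_order all_algebra.
From mathcomp Require Export all_classical all_reals all_analysis.
From mathcomp.real_closed Require Export complex.
Import numFieldNormedType.Exports.

Set Implicit Arguments.
Unset Strict Implicit.
Unset Printing Implicit Defensive.

Local Open Scope classical_set_scope.
Local Open Scope ring_scope.

(* The complex numbers, for an arbitrary [R : realType].  The structure is
   forgotten down to [numClosedFieldType] because this is what carries the
   topology of the modulus, hence the one of C^n = ['rV[CC R]_n]. *)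
Definition CC (R : realType) : numClosedFieldType := R[i].

Record opens (X : topologicalType) : Type := Opens {
  oset :> set X;
  oset_open : open oset }.

Definition opens_mem (X : topologicalType) (U : opens X) (x : X) : Prop :=
  oset U x.
Coercion opens_mem : opens >-> Funclass.

(* The separation and gluing axioms range over coverings [V] of [U]; local
   sections are compatible when they agree on every open set contained in two
   members of the covering. *)
Definition is_sheaf (X : topologicalType) (F : opens X -> Type)
    (r : forall U V : opens X, U `<=` V -> F V -> F U) : Prop :=
  [/\ forall (U : opens X) (h : U `<=` U) (s : F U), r U U h s = s,
      forall (U V W : opens X) (h : U `<=` V) (k : V `<=` W) (l : U `<=` W)
        (s : F W), r U V h (r V W k s) = r U W l s
    & forall (U : opens X) (I : Type) (V : I -> opens X)
        (h : forall i, V i `<=` U),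
        U `<=` \bigcup_(i in [set: I]) V i ->
        forall s : forall i, F (V i),
        (forall (i j : I) (W : opens X) (hi : W `<=` V i) (hj : W `<=` V j),
           r W (V i) hi (s i) = r W (V j) hj (s j)) ->
        exists! t : F U, forall i, r (V i) U (h i) t = s i].

(* Germs of local sections of a presheaf [F], for a notion [agree N s t] of two
   sections [s], [t] being identified on [N].  The germ of [s] at [y] is the
   equivalence class of [s], as a set of local sections. *)
Section Germs.
Variables (Y : topologicalType) (F : opens Y -> Type).
Variable agree :
  forall N V V' : opens Y, N `<=` V -> N `<=` V' -> F V -> F V' -> Prop.

Definition germ (y : Y) (V : opens Y) (s : F V) : set {V : opens Y & F V} :=
  [set t : {V : opens Y & F V} | exists (N : opens Y) (h : N `<=` V) (h' : N `<=` projT1 t),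
     N y /\ agree h h' s (projT2 t)].

(* Sections over [U] of the inverse image under [f : X -> Y] of the sheaf
   associated with [F] modulo [agree]: germs at the points [f x], [x] in [U],
   given locally on [X] by sections of [F].  The value outside [U] is
   normalised.  For [f = id] this is the associated sheaf itself. *)
Record invimage (X : topologicalType) (f : X -> Y) (U : opens X) : Type :=
  InvImage {
    ii_germ :> X -> set {V : opens Y & F V};
    ii_out : forall x, ~ U x -> ii_germ x = set0;
    ii_loc : forall x, U x ->
      exists (N : opens X) (V : opens Y) (s : F V),
        [/\ N x, N `<=` U, N `<=` f @^-1` V
          & forall y, N y -> ii_germ y = germ (f y) s] }.
End Germs.

(* The rings of sections are possibly trivial since O(set0) = 0.  [rs_cst] is
   the structure of sheaf of complex algebras. *)
Record ringedSpace (R : realType) : Type := RingedSpace {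
  rs_space :> topologicalType;
  rs_fun : opens rs_space -> comPzRingType;
  rs_res : forall U V : opens rs_space, U `<=` V ->
    {rmorphism rs_fun V -> rs_fun U};
  rs_cst : forall U : opens rs_space, {rmorphism CC R -> rs_fun U};
  rs_res_cst : forall (U V : opens rs_space) (h : U `<=` V) (c : CC R),
    rs_res h (rs_cst V c) = rs_cst U c;
  rs_sheaf : is_sheaf (fun U V h => rs_res h : rs_fun V -> rs_fun U) }.

Arguments rs_cst {R r} U.

Definition preim (X Y : topologicalType) (f : X -> Y) (hf : continuous f)
    (V : opens Y) : opens X :=
  Opens ((continuousP f).1 hf _ (oset_open V)).

Record rsMorphism (R : realType) (X S : ringedSpace R) : Type := RsMorphism {
  rm_map :> X -> S;
  rm_cont : continuous rm_map;
  rm_pull : forall V : opens S,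
    {rmorphism rs_fun V -> rs_fun (preim rm_cont V)};
  rm_pull_res : forall (V W : opens S) (h : V `<=` W)
      (h' : preim rm_cont V `<=` preim rm_cont W) (g : rs_fun W),
    rm_pull V (rs_res h g) = rs_res h' (rm_pull W g);
  rm_pull_cst : forall (V : opens S) (c : CC R),
    rm_pull V (rs_cst V c) = rs_cst (preim rm_cont V) c }.

Arguments rm_cont {R X S} r.

(* The pull-back of [g : O_S(V)] to an open set [U] contained in the preimage
   of [V]. *)
Definition pull (R : realType) (X S : ringedSpace R) (p : rsMorphism X S)
    (U : opens X) (V : opens S) (h : U `<=` p @^-1` V) (g : rs_fun V) :
    rs_fun U :=
  rs_res (h : U `<=` preim (rm_cont p) V) (rm_pull p V g).

Definition holomorphic_on (R : realType) (n : nat) (V : set 'rV[CC R]_n)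
    (g : 'rV[CC R]_n -> CC R) : Prop :=
  forall z : 'rV[CC R]_n, V z -> differentiable g z.

(* [local_model W D f phi theta]: the open subspace [W] of [X] is identified by
   [phi] with the analytic subspace of the open set [D] of C^n with ideal
   generated by the holomorphic functions [f_i].  [theta N g] is the section
   [g o phi] of O_X over [N], used only for [g] holomorphic on an open set
   containing [phi N]. *)
Record local_model (R : realType) (X : ringedSpace R) (W : opens X) (n k : nat)
    (D : opens 'rV[CC R]_n) (f : 'I_k -> 'rV[CC R]_n -> CC R)
    (phi : X -> 'rV[CC R]_n)
    (theta : forall N : opens X, ('rV[CC R]_n -> CC R) -> rs_fun N) : Prop :=
  LocalModel {
    lm_hol : forall i, holomorphic_on D (f i);
    lm_image : phi @` W = [set z | D z /\ forall i, f i z = 0];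
    lm_inj : forall x y, W x -> W y -> phi x = phi y -> x = y;
    lm_topology : forall N : set X, N `<=` W ->
      (open N <-> exists2 V, open V & N = W `&` phi @^-1` V);
    lm_add : forall (N : opens X) (V : opens 'rV[CC R]_n) g h,
      N `<=` W -> N `<=` phi @^-1` V ->
      holomorphic_on V g -> holomorphic_on V h ->
      theta N (fun z => g z + h z) = theta N g + theta N h;
    lm_mul : forall (N : opens X) (V : opens 'rV[CC R]_n) g h,
      N `<=` W -> N `<=` phi @^-1` V ->
      holomorphic_on V g -> holomorphic_on V h ->
      theta N (fun z => g z * h z) = theta N g * theta N h;
    lm_cst : forall (N : opens X) (c : CC R), N `<=` W ->
      theta N (fun=> c) = rs_cst N c;
    lm_res : forall (N N' : opens X) (V : opens 'rV[CC R]_n) g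
        (h : N' `<=` N),
      N `<=` W -> N `<=` phi @^-1` V -> holomorphic_on V g ->
      rs_res h (theta N g) = theta N' g;
    lm_surj : forall (N : opens X) (s : rs_fun N) x, N `<=` W -> N x ->
      exists (N' : opens X) (h : N' `<=` N) (V : opens 'rV[CC R]_n) g,
        [/\ N' x, N' `<=` phi @^-1` V, holomorphic_on V g
          & rs_res h s = theta N' g];
    lm_ker : forall (N : opens X) (V : opens 'rV[CC R]_n) g x,
      N `<=` W -> N x -> N `<=` phi @^-1` V -> holomorphic_on V g ->
      ((exists (N' : opens X) (h : N' `<=` N),
          N' x /\ rs_res h (theta N g) = 0)
       <->
       (exists (V' : opens 'rV[CC R]_n) (a : 'I_k -> 'rV[CC R]_n -> CC R),
          [/\ V' (phi x), V' `<=` V `&` D, forall i, holomorphic_on V' (a i)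
            & forall z, V' z -> g z = \sum_(i < k) a i z * f i z])) }.

Definition complex_space (R : realType) (X : ringedSpace R) : Prop :=
  hausdorff_space X /\
  forall x : X, exists (W : opens X) (n k : nat) (D : opens 'rV[CC R]_n)
      (f : 'I_k -> 'rV[CC R]_n -> CC R) (phi : X -> 'rV[CC R]_n)
      (theta : forall N : opens X, ('rV[CC R]_n -> CC R) -> rs_fun N),
    W x /\ local_model W D f phi theta.

(* Near every point the source is an open subspace of the product of the target
   and some C^d, the morphism being the projection: in C^(n + d), the source is
   defined by the equations of the target, in the first [n] coordinates. *)
Definition smooth (R : realType) (X S : ringedSpace R) (p : rsMorphism X S) :
    Prop :=
  forall x : X, exists (n d k : nat)
      (M : opens S) (D : opens 'rV[CC R]_n) (f : 'I_k -> 'rV[CC R]_n -> CC R)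
      (phi : S -> 'rV[CC R]_n)
      (theta : forall N : opens S, ('rV[CC R]_n -> CC R) -> rs_fun N)
      (W : opens X) (E : opens 'rV[CC R]_(n + d))
      (psi : X -> 'rV[CC R]_(n + d))
      (eta : forall N : opens X, ('rV[CC R]_(n + d) -> CC R) -> rs_fun N),
    [/\ W x, W `<=` p @^-1` M,
        local_model M D f phi theta,
        local_model W E (fun i z => f i (lsubmx z)) psi eta
      & [/\ forall z, E z -> D (lsubmx z),
            forall y, W y -> lsubmx (psi y) = phi (p y)
          & forall (N : opens X) (N' : opens S) (V : opens 'rV[CC R]_n) g
              (h : N `<=` p @^-1` N'),
              N `<=` W -> N' `<=` M -> N' `<=` phi @^-1` V ->
              holomorphic_on V g ->
              eta N (fun z => g (lsubmx z)) = pull h (theta N' g)]].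

(* Sections over [U] of the tangent sheaf, as C-linear derivations of the sheaf
   of rings O_X restricted to [U]. *)
Record deriv (R : realType) (X : ringedSpace R) (U : opens X) : Type := Deriv {
  der :> forall V : opens X, V `<=` U -> rs_fun V -> rs_fun V;
  der_res : forall (V W : opens X) (hV : V `<=` U) (hW : W `<=` U)
      (h : V `<=` W) (g : rs_fun W),
    der hV (rs_res h g) = rs_res h (der hW g);
  der_add : forall (V : opens X) (hV : V `<=` U) (f g : rs_fun V),
    der hV (f + g) = der hV f + der hV g;
  der_mul : forall (V : opens X) (hV : V `<=` U) (f g : rs_fun V),
    der hV (f * g) = der hV f * g + f * der hV g;
  der_cst : forall (V : opens X) (hV : V `<=` U) (c : CC R),
    der hV (rs_cst V c) = 0 }.

Definition deriv_agree (R : realType) (X : ringedSpace R)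
    (N V V' : opens X) (h : N `<=` V) (h' : N `<=` V')
    (D : deriv V) (D' : deriv V') : Prop :=
  forall (W : opens X) (k : W `<=` N) (kV : W `<=` V) (kV' : W `<=` V')
    (g : rs_fun W), D W kV g = D' W kV' g.

Definition vertical (R : realType) (X S : ringedSpace R) (p : rsMorphism X S)
    (U : opens X) (D : deriv U) : Prop :=
  forall (W : opens X) (hW : W `<=` U) (V : opens S) (h : W `<=` p @^-1` V)
    (g : rs_fun V), D W hW (pull h g) = 0.

(* [projects x D v]: the class of [D] in T_X / T_{X|S} = p^* T_S is, near [x],
   the section 1 (x) v of p^* T_S.  A class of T_X / T_{X|S} is determined by
   the derivation [g |-> D (p^# g)] from p^-1 O_S to O_X, and that of 1 (x) v is
   [g |-> p^# (v g)]. *)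
Definition projects (R : realType) (X S : ringedSpace R) (p : rsMorphism X S)
    (x : X) (U : opens X) (D : deriv U) (V : opens S) (v : deriv V) : Prop :=
  exists N : opens X,
    [/\ N x, N `<=` U, N `<=` p @^-1` V
      & forall (W : opens X) (kU : W `<=` U) (M : opens S) (kV : M `<=` V)
          (h : W `<=` p @^-1` M) (g : rs_fun M),
          W `<=` N -> D W kU (pull h g) = pull h (v M kV g)].

(* Sections over [U] of p^-1 T_S, and the canonical map
   T_S(V) -> (p_* p^-1 T_S)(V), as a relation. *)
Definition invT (R : realType) (X S : ringedSpace R) (p : rsMorphism X S)
    (U : opens X) : Type :=
  @invimage S (@deriv R S) (@deriv_agree R S) X p U.

Definition invT_of (R : realType) (X S : ringedSpace R) (p : rsMorphism X S)
    (V : opens S) (v : deriv V) (w : invT p (preim (rm_cont p) V)) : Prop :=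
  forall x, preim (rm_cont p) V x -> w x = germ (@deriv_agree R S) (p x) v.

Definition pushforward_invT_iso (R : realType) (X S : ringedSpace R)
    (p : rsMorphism X S) : Prop :=
  forall (V : opens S) (w : invT p (preim (rm_cont p) V)),
    exists! v : deriv V, invT_of v w.

Record omodule (R : realType) (X : ringedSpace R) : Type := OModule {
  om_sec :> forall U : opens X, lmodType (rs_fun U);
  om_res : forall U V : opens X, U `<=` V -> om_sec V -> om_sec U;
  om_res_add : forall (U V : opens X) (h : U `<=` V) (s t : om_sec V),
    om_res h (s + t) = om_res h s + om_res h t;
  om_res_scale : forall (U V : opens X) (h : U `<=` V) (g : rs_fun V)
      (s : om_sec V),
    om_res h (g *: s) = rs_res h g *: om_res h s;
  om_sheaf : is_sheaf om_res }.

Section Coherent.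
Variables (R : realType) (X : ringedSpace R) (F : omodule X).

Definition locally_finite_type : Prop :=
  forall x : X, exists (N : opens X) (n : nat) (e : 'I_n -> F N),
    N x /\
    forall (W : opens X) (h : W `<=` N) (s : F W) y, W y ->
      exists (W' : opens X) (k : W' `<=` W) (l : W' `<=` N)
        (c : 'I_n -> rs_fun W'),
        W' y /\ om_res k s = \sum_(i < n) c i *: om_res l (e i).

Definition locally_finite_relations : Prop :=
  forall (U : opens X) (n : nat) (e : 'I_n -> F U) (x : X), U x ->
    exists (N : opens X) (h : N `<=` U) (m : nat)
      (c : 'I_m -> 'I_n -> rs_fun N),
      [/\ N x, forall j, \sum_(i < n) c j i *: om_res h (e i) = 0
        & forall (W : opens X) (k : W `<=` N) (l : W `<=` U)
            (a : 'I_n -> rs_fun W) y, W y ->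
            \sum_(i < n) a i *: om_res l (e i) = 0 ->
            exists (W' : opens X) (k' : W' `<=` W) (l' : W' `<=` N)
              (b : 'I_m -> rs_fun W'),
              W' y /\
              forall i, rs_res k' (a i) =
                        \sum_(j < m) b j * rs_res l' (c j i)].

Definition coherent : Prop := locally_finite_type /\ locally_finite_relations.

Record dual (U : opens X) : Type := Dual {
  dual_map :> forall V : opens X, V `<=` U -> F V -> rs_fun V;
  dual_res : forall (V W : opens X) (hV : V `<=` U) (hW : W `<=` U)
      (h : V `<=` W) (s : F W),
    dual_map hV (om_res h s) = rs_res h (dual_map hW s);
  dual_add : forall (V : opens X) (hV : V `<=` U) (s t : F V),
    dual_map hV (s + t) = dual_map hV s + dual_map hV t;
  dual_scale : forall (V : opens X) (hV : V `<=` U) (g : rs_fun V) (s : F V),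
    dual_map hV (g *: s) = g * dual_map hV s }.

(* The conditions on [bidual_map] are linearity over O_X and compatibility with
   the restriction maps of the dual sheaf, whose operations appear in relational
   form. *)
Record bidual (U : opens X) : Type := Bidual {
  bidual_map :> forall V : opens X, V `<=` U -> dual V -> rs_fun V;
  bidual_res : forall (V W : opens X) (hV : V `<=` U) (hW : W `<=` U)
      (h : V `<=` W) (l : dual W) (m : dual V),
    (forall (V' : opens X) (k : V' `<=` V) (k' : V' `<=` W) (s : F V'),
       m V' k s = l V' k' s) ->
    bidual_map hV m = rs_res h (bidual_map hW l);
  bidual_linear : forall (V : opens X) (hV : V `<=` U) (g : rs_fun V)
      (l m n : dual V),
    (forall (V' : opens X) (k : V' `<=` V) (s : F V'),
       n V' k s = rs_res k g * l V' k s + m V' k s) ->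
    bidual_map hV n = g * bidual_map hV l + bidual_map hV m }.

Definition reflexive_sheaf : Prop :=
  coherent /\
  forall (U : opens X) (b : bidual U),
    exists! s : F U, forall (V : opens X) (h : V `<=` U) (l : dual V)
      (k : V `<=` V), b V h l = l V k (om_res h s).

End Coherent.

(* [tensor_zero l]: the element \sum m (x) n, over the pairs (m, n) in [l], of
   the tensor product of [M] and [N] is zero. *)
Definition tensor_zero (B : comPzRingType) (M N : lmodType B)
    (l : seq (M * N)) : Prop :=
  forall (P : lmodType B) (beta : M -> N -> P),
    (forall n b m m', beta (b *: m + m') n = b *: beta m n + beta m' n) ->
    (forall m b n n', beta m (b *: n + n') = b *: beta m n + beta m n') ->
    \sum_(q <- l) beta q.1 q.2 = 0.

Definition flat_module (B : comPzRingType) (M : lmodType B) : Prop :=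
  forall (N N' : lmodType B) (f : {linear N -> N'}), injective f ->
    forall l : seq (M * N),
      tensor_zero [seq (q.1, f q.2) | q <- l] -> tensor_zero l.

(* [T], with the maps [gam] sending a section near [x] to its germ, is the stalk
   at [x] of the presheaf [F]. *)
Definition is_stalk (X : topologicalType) (F : opens X -> Type)
    (r : forall U V : opens X, U `<=` V -> F V -> F U) (x : X)
    (T : Type) (gam : forall U : opens X, U x -> F U -> T) : Prop :=
  (forall t : T, exists (U : opens X) (hU : U x) (s : F U), gam U hU s = t) /\
  (forall (U V : opens X) (hU : U x) (hV : V x) (s : F U) (t : F V),
     gam U hU s = gam V hV t <->
     exists (N : opens X) (h : N `<=` U) (h' : N `<=` V),
       N x /\ r N U h s = r N V h' t).

(* The stalks are characterised up to isomorphism by [is_stalk]. *)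
Definition flat_over (R : realType) (X S : ringedSpace R)
    (p : rsMorphism X S) (F : omodule X) : Prop :=
  forall (x : X) (B : comPzRingType)
    (gam : forall V : opens S, V (p x) -> {rmorphism rs_fun V -> B})
    (M : lmodType B) (mu : forall U : opens X, U x -> F U -> M),
    is_stalk (fun U V h => @rs_res R S U V h : rs_fun V -> rs_fun U)
      (fun V hV => gam V hV : rs_fun V -> B) ->
    is_stalk (@om_res R X F) mu ->
    (forall (U : opens X) (hU : U x) (s t : F U),
       mu U hU (s + t) = mu U hU s + mu U hU t) ->
    (forall (U : opens X) (hU : U x) (V : opens S) (hV : V (p x))
       (h : U `<=` p @^-1` V)
       (g : rs_fun V) (s : F U),
       mu U hU (pull h g *: s) = gam V hV g *: mu U hU s) ->
    flat_module M.

(* Reflexivity of the underlying sheaf is kept apart, because the sheaf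
   p_* u(A) of a family [A] can have torsion: for p the identity of the line and
   A = sl_2 (x) O with zero anchor and the bracket of sl_2 multiplied by the
   coordinate z, the class of an operator [e, -], with e in sl_2 nonzero, is
   nonzero in u(A) and killed by z. *)
Record lie_axioms (R : realType) (X : ringedSpace R) (A : omodule X)
    (a : forall U : opens X, A U -> deriv U)
    (b : forall U : opens X, A U -> A U -> A U) : Prop := LieAxioms {
  la_anchor_res : forall (U V : opens X) (h : U `<=` V) (s : A V)
      (W : opens X) (k : W `<=` U) (l : W `<=` V) (g : rs_fun W),
    a U (om_res h s) W k g = a V s W l g;
  la_anchor_linear : forall (U : opens X) (f : rs_fun U) (s t : A U)
      (W : opens X) (k : W `<=` U) (g : rs_fun W),
    a U (f *: s + t) W k g = rs_res k f * a U s W k g + a U t W k g;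
  la_bracket_res : forall (U V : opens X) (h : U `<=` V) (s t : A V),
    om_res h (b V s t) = b U (om_res h s) (om_res h t);
  la_bilinear_l : forall (U : opens X) (c : CC R) (s s' t : A U),
    b U (rs_cst U c *: s + s') t = rs_cst U c *: b U s t + b U s' t;
  la_bilinear_r : forall (U : opens X) (c : CC R) (s t t' : A U),
    b U s (rs_cst U c *: t + t') = rs_cst U c *: b U s t + b U s t';
  la_antisym : forall (U : opens X) (s t : A U), b U s t = - b U t s;
  la_jacobi : forall (U : opens X) (s t u : A U),
    b U s (b U t u) + b U t (b U u s) + b U u (b U s t) = 0;
  la_leibniz : forall (U : opens X) (k : U `<=` U) (g : rs_fun U) (u v : A U),
    b U (g *: u) v = g *: b U u v - a U v U k g *: u }.

Record lie_family (R : realType) (X S : ringedSpace R) (p : rsMorphism X S) :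
    Type := LieFamily {
  lf_mod :> omodule X;
  lf_anchor : forall U : opens X, lf_mod U -> deriv U;
  lf_bracket : forall U : opens X, lf_mod U -> lf_mod U -> lf_mod U;
  lf_reflexive : reflexive_sheaf lf_mod;
  lf_flat : flat_over p lf_mod;
  lf_axioms : lie_axioms lf_anchor lf_bracket;
  lf_vertical : forall (U : opens X) (s : lf_mod U),
    vertical p (lf_anchor s);
  lf_bilinear_l : forall (U : opens X) (V : opens S) (h : U `<=` p @^-1` V)
      (g : rs_fun V) (s t : lf_mod U),
    lf_bracket (pull h g *: s) t = pull h g *: lf_bracket s t;
  lf_bilinear_r : forall (U : opens X) (V : opens S) (h : U `<=` p @^-1` V)
      (g : rs_fun V) (s t : lf_mod U),
    lf_bracket s (pull h g *: t) = pull h g *: lf_bracket s t }.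

Arguments lf_bracket {R X S p} l U.

(* No nonzero local section of O_X annihilates [F]; this is what makes the
   symbol of a differential operator on [F] unique. *)
Definition faithful_sheaf (R : realType) (X : ringedSpace R) (F : omodule X) :
    Prop :=
  forall (U : opens X) (g : rs_fun U),
    (forall (W : opens X) (h : W `<=` U) (s : F W), rs_res h g *: s = 0) ->
    g = 0.

Section U.
Variables (R : realType) (X S : ringedSpace R) (p : rsMorphism X S).
Variable A : lie_family p.

(* Sections over [U] of the sheaf of C-linear endomorphisms of [A]. *)
Record endo (U : opens X) : Type := Endo {
  endo_map :> forall V : opens X, V `<=` U -> A V -> A V;
  endo_res : forall (V W : opens X) (hV : V `<=` U) (hW : W `<=` U)
      (h : V `<=` W) (s : A W),
    endo_map hV (om_res h s) = om_res h (endo_map hW s);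
  endo_linear : forall (V : opens X) (hV : V `<=` U) (c : CC R) (s t : A V),
    endo_map hV (rs_cst V c *: s + t) =
    rs_cst V c *: endo_map hV s + endo_map hV t }.

Definition diffop1 (U : opens X) (psi : endo U) : Prop :=
  forall (V : opens X) (hV : V `<=` U) (g : rs_fun V),
    exists psi_g : rs_fun V,
      forall (W : opens X) (hW : W `<=` U) (h : W `<=` V) (s : A W),
        psi W hW (rs_res h g *: s) - rs_res h g *: psi W hW s =
        rs_res h psi_g *: s.

Definition is_symbol (U : opens X) (psi : endo U) (D : deriv U) : Prop :=
  forall (V : opens X) (hV : V `<=` U) (g : rs_fun V) (s : A V),
    psi V hV (g *: s) - g *: psi V hV s = D V hV g *: s.

Definition lie_derivation (U : opens X) (psi : endo U) : Prop :=
  forall (V : opens X) (hV : V `<=` U) (s t : A V),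
    psi V hV (lf_bracket A V s t) =
    lf_bracket A V (psi V hV s) t + lf_bracket A V s (psi V hV t).

(* Sections of the intersection of Der_Lie(A) and D^{<= 1}(A). *)
Record lie_diffop (U : opens X) : Type := LieDiffop {
  ld_op :> endo U;
  ld_lie : lie_derivation ld_op;
  ld_order : diffop1 ld_op }.

(* Equality on [N] modulo the image of A under [al |-> {al, -}]. *)
Definition op_agree (N V V' : opens X) (h : N `<=` V) (h' : N `<=` V')
    (psi : lie_diffop V) (psi' : lie_diffop V') : Prop :=
  exists al : A N,
    forall (W : opens X) (k : W `<=` N) (kV : W `<=` V) (kV' : W `<=` V')
      (s : A W),
      psi W kV s - psi' W kV' s = lf_bracket A W (om_res k al) s.

(* Sections over [U] of the quotient sheaf (Der_Lie(A) /\ D^{<= 1}(A)) / A; the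
   local representatives at [x] of such a [q] are the elements of [q x]. *)
Definition outer (U : opens X) : Type :=
  @invimage X lie_diffop op_agree X id U.

(* The image of [q] under the symbol map to T_X / T_{X|S} = p^* T_S lies in
   p^-1 T_S. *)
Definition in_u (U : opens X) (q : outer U) : Prop :=
  forall x, U x ->
    exists (N : opens X) (psi : lie_diffop N) (D : deriv N)
      (V : opens S) (v : deriv V),
      [/\ q x (existT _ N psi), is_symbol psi D, V (p x) & projects p x D v].

Definition usec (U : opens X) : Type := {q : outer U | in_u q}.

Definition urep (U : opens X) (q : usec U) (x : X) (N : opens X)
    (psi : lie_diffop N) : Prop :=
  ii_germ (sval q) x (existT _ N psi).

(* The operations of u(A), on local representatives: [Phi psi1 psi2] represents
   [q3] whenever [psi1], [psi2] represent [q1], [q2]. *)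
Definition u_op2
    (Phi : forall W : opens X, (A W -> A W) -> (A W -> A W) -> A W -> A W)
    (U : opens X) (q1 q2 q3 : usec U) : Prop :=
  forall x, U x ->
  forall (V1 V2 V3 : opens X) (psi1 : lie_diffop V1) (psi2 : lie_diffop V2)
    (psi3 : lie_diffop V3),
    urep q1 x psi1 -> urep q2 x psi2 -> urep q3 x psi3 ->
    exists (N : opens X) (al : A N),
      [/\ N x, N `<=` V1, N `<=` V2, N `<=` V3
        & forall (W : opens X) (k : W `<=` N) (k1 : W `<=` V1)
            (k2 : W `<=` V2) (k3 : W `<=` V3) (s : A W),
            psi3 W k3 s = Phi W (psi1 W k1) (psi2 W k2) s
                          + lf_bracket A W (om_res k al) s].

Definition u_add : forall U : opens X, usec U -> usec U -> usec U -> Prop :=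
  u_op2 (fun W f g s => f s + g s).

Definition u_bracket : forall U : opens X,
    usec U -> usec U -> usec U -> Prop :=
  u_op2 (fun W f g s => f (g s) - g (f s)).

(* [r = g q] for the p^-1 O_S-module structure, [g : O_S(V)]. *)
Definition u_scale (U : opens X) (V : opens S) (g : rs_fun V) (q r : usec U) :
    Prop :=
  forall x, U x ->
  forall (V1 V2 : opens X) (psi1 : lie_diffop V1) (psi2 : lie_diffop V2),
    urep q x psi1 -> urep r x psi2 ->
    exists (N : opens X) (al : A N),
      [/\ N x, N `<=` V1, N `<=` V2, N `<=` p @^-1` V
        & forall (W : opens X) (k : W `<=` N) (k1 : W `<=` V1)
            (k2 : W `<=` V2) (h : W `<=` p @^-1` V) (s : A W),
            psi2 W k2 s = pull h g *: psi1 W k1 s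
                          + lf_bracket A W (om_res k al) s].

(* [w] is the image of [q] under the map a_u : u(A) -> p^-1 T_S. *)
Definition u_anchor (U : opens X) (q : usec U) (w : invT p U) : Prop :=
  forall x, U x ->
  forall (N : opens X) (psi : lie_diffop N) (D : deriv N)
    (V : opens S) (v : deriv V),
    urep q x psi -> is_symbol psi D -> ii_germ w x (existT _ V v) ->
    projects p x D v.

End U.

(* The direct image p_* u(A), with its O_S-module structure, its bracket and its
   anchor to p_* p^-1 T_S, is isomorphic to the O_S-module [L] with bracket [b]
   and anchor [a]. *)
Record pushforward_u_iso (R : realType) (X S : ringedSpace R)
    (p : rsMorphism X S) (A : lie_family p) (L : omodule S)
    (a : forall V : opens S, L V -> deriv V)
    (b : forall V : opens S, L V -> L V -> L V)
    (iota : forall V : opens S, L V -> usec A (preim (rm_cont p) V)) : Prop :=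
  PushforwardUIso {
    pu_bij : forall V, bijective (@iota V);
    pu_res : forall (V W : opens S) (h : V `<=` W) (l : L W) x,
      preim (rm_cont p) V x ->
      ii_germ (sval (iota V (om_res h l))) x = ii_germ (sval (iota W l)) x;
    pu_add : forall V (l m : L V),
      u_add (iota V l) (iota V m) (iota V (l + m));
    pu_scale : forall V (g : rs_fun V) (l : L V),
      u_scale g (iota V l) (iota V (g *: l));
    pu_bracket : forall V (l m : L V),
      u_bracket (iota V l) (iota V m) (iota V (b V l m));
    pu_anchor : forall V (l : L V) (w : invT p (preim (rm_cont p) V)),
      invT_of (a V l) w -> u_anchor (iota V l) w }.

(* Main.v *)
From HB Require Import structures.
From mathcomp Require Import ring.
Require Import Defs.
Import GRing.Theory.
Import numFieldNormedType.Exports.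

Set Implicit Arguments.
Unset Strict Implicit.
Unset Printing Implicit Defensive.

Local Open Scope classical_set_scope.
Local Open Scope ring_scope.

(* The sections of p_* u(A) over V are those of u(A) over the preimage of V;
   module operations, bracket and restriction are computed on local operators,
   and all axioms are checked there.  A smooth morphism is open and injective on
   germs of functions, because it has local sections (slices of a product), so
   the projection of a symbol to S determines a germ of vector field on S: this
   defines the map to p_* p^-1 T_S, hence the anchor by p_* p^-1 T_S = T_S.  The
   Leibniz rule holds since, for psi with symbol D lifting v,
   [g phi, psi] = g [phi, psi] - D(p^# g) phi = g [phi, psi] - p^#(v g) phi. *)

(** * Ringed spaces *)

Section Opens.
Variable X : topologicalType.

(** A section of u(A) has no canonical representative: it is a family of classes of operators modulo
    inner derivations, each operator living on its own open set. Constructions therefore go through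
    relations: a section is produced from a predicate on local operators that is satisfied near
    every point and singles out one germ, and equalities are tested on representatives with a common
    domain. A single operation g psi + phi carries the whole module structure (g = 1 gives the sum,
    phi = 0 the scalar multiple), so that well-definedness is checked once. The bracket descends
    because inner derivations form an ideal: [psi, {al, -}] = {psi al, -}. Faithfulness of A lets
    symbols be compared through the action of functions on A. The isomorphism T_S -> p_* p^-1 T_S
    enters through both halves: surjectivity assembles the germs at the points p x into a vector
    field on V, while injectivity gives the compatibility of the anchor with restrictions and linear
    combinations. The latter is not automatic, since p need not be surjective and germs at points of
    the image may miss part of V. *)

Definition opensI (U V : opens X) : opens X :=
  Opens (openI (oset_open U) (oset_open V)).

Lemma opensIl (U V : opens X) : opensI U V `<=` U.
Proof. by move=> x []. Qed.

Lemma opensIr (U V : opens X) : opensI U V `<=` V.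
Proof. by move=> x []. Qed.

End Opens.

Section RingedSpace.
Variables (R : realType) (X : ringedSpace R).

Lemma rs_res_id (U : opens X) (h : U `<=` U) (g : rs_fun U) : rs_res h g = g.
Proof. by have [+ _ _] := rs_sheaf X; exact. Qed.

Lemma rs_res_comp (U V W : opens X) (h : U `<=` V) (k : V `<=` W)
  (l : U `<=` W) (g : rs_fun W) : rs_res h (rs_res k g) = rs_res l g.
Proof. by have [_ + _] := rs_sheaf X; exact. Qed.

(** Both [g] and 0 glue the zero family on the covering by all open sets where [g] vanishes; gluings
    are unique. *)
Lemma rs_fun_local_eq0 (U : opens X) (g : rs_fun U) :
  (forall x, U x -> exists (N : opens X) (h : N `<=` U),
    N x /\ rs_res h g = 0) -> g = 0.
Proof.
move=> g0; have [_ _ glue] := rs_sheaf X.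
pose I := {N : opens X | exists h : N `<=` U, rs_res h g = 0}.
pose V (i : I) := sval i.
have hV (i : I) : V i `<=` U by case: (svalP i).
have [|i j W hi hj|t [_ tU]] := glue U I V hV _ (fun=> 0).
- by move=> x /g0[N [h [Nx gN]]]; exists (exist _ N (ex_intro _ h gN)).
- by rewrite !rmorph0.
rewrite -(tU g); last first.
  move=> [N [h gN]]; rewrite -[RHS]gN.
  by congr (rs_res _ g); exact: Prop_irrelevance.
by apply: tU => i; rewrite rmorph0.
Qed.

End RingedSpace.

Section Pull.
Variables (R : realType) (X S : ringedSpace R) (p : rsMorphism X S).

Lemma pull_res (W : opens X) (M V : opens S) (k : M `<=` V)
    (h : W `<=` p @^-1` M) (h' : W `<=` p @^-1` V) (g : rs_fun V) :
  pull h (rs_res k g) = pull h' g.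
Proof.
have kp : preim (rm_cont p) M `<=` preim (rm_cont p) V by move=> x /k.
by rewrite /pull (rm_pull_res k kp) rs_res_comp.
Qed.

Lemma res_pull (W W' : opens X) (V : opens S) (k : W' `<=` W)
    (h : W `<=` p @^-1` V) (h' : W' `<=` p @^-1` V) (g : rs_fun V) :
  rs_res k (pull h g) = pull h' g.
Proof. by rewrite /pull rs_res_comp. Qed.

Lemma pull_cst (W : opens X) (V : opens S) (h : W `<=` p @^-1` V) (c : CC R) :
  pull h (rs_cst V c) = rs_cst W c.
Proof. by rewrite /pull rm_pull_cst rs_res_cst. Qed.

End Pull.

(** * Slices and projections of the product of C^n and C^d *)

Section RowVectors.
Variables (K : numFieldType).

Lemma continuous_row_mx n d (c : 'rV[K]_d) :
  continuous (fun z : 'rV[K]_n => row_mx z c).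
Proof.
move=> z B /nbhs_ballP[e e0 zB]; apply/nbhs_ballP; exists e => // y [_ zy].
apply: zB; split=> // i j; rewrite !mxE; case: (fintype.split j) => k.
  exact: zy.
exact: ballxx.
Qed.

Lemma continuous_lsubmx n d : continuous (fun z : 'rV[K]_(n + d) => lsubmx z).
Proof.
move=> z B /nbhs_ballP[e e0 zB]; apply/nbhs_ballP; exists e => // y [_ zy].
by apply: zB; split=> // i j; rewrite !mxE.
Qed.

Lemma differentiable_lsubmx n d (z : 'rV[K]_(n + d)) :
  differentiable (fun z : 'rV[K]_(n + d) => lsubmx z) z.
Proof.
exact: (@linear_differentiable _ _ _ (lsubmx : {linear _ -> _})
  _ (@continuous_lsubmx n d)).
Qed.

Lemma differentiable_row_mx n d (c : 'rV[K]_d) (z : 'rV[K]_n) :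
  differentiable (fun z : 'rV[K]_n => row_mx z c) z.
Proof.
pose f (z : 'rV[K]_n) : 'rV[K]_(n + d) := row_mx z 0.
have fl : linear f.
  by move=> a u v; rewrite /f scale_row_mx add_row_mx scaler0 addr0.
pose fL : {linear _ -> _} := HB.pack f (GRing.isLinear.Build _ _ _ _ f fl).
have -> : (fun z : 'rV[K]_n => row_mx z c) =
    (fL : 'rV[K]_n -> 'rV[K]_(n + d)) + cst (row_mx 0 c).
  by apply/funext => y; rewrite fctE /= /f add_row_mx addr0 add0r.
apply: differentiableD => //; apply: linear_differentiable.
exact: continuous_row_mx.
Qed.

End RowVectors.

(** * Smooth morphisms *)

Section Smooth.
Variables (R : realType) (X S : ringedSpace R) (p : rsMorphism X S).
Hypothesis hp : smooth p.

(** With [c] the fibre coordinates of a point [x], the assignment s |-> (phi s, c) is, in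
    coordinates, a local section of [p] through [x]; this is the domain it cuts out of [V]. *)
Let slice n d (V : opens 'rV[CC R]_(n + d)) (c : 'rV[CC R]_d) :
    opens 'rV[CC R]_n :=
  preim (@continuous_row_mx _ n d c) V.

(** Each point [x] of [N] lies on a local section of [p], and the points near [p x] are reached
    along it inside [N]. *)
Lemma smooth_open (N : opens X) : open (p @` N).
Proof.
rewrite openE => _ [x Nx <-].
have [n [d [k [M [D [f [phi [theta [W [E [psi [eta]]]]]]]]]]]] := hp x.
move=> [Wx WM lmS lmX [ED psiphi _]].
have [V oV NV] := (lm_topology lmX (@opensIr _ N W)).1 (oset_open _).
set c := rsubmx (psi x).
have psix : row_mx (phi (p x)) c = psi x by rewrite -psiphi// hsubmxK.
have Vx : V (psi x) by have : (N `&` W) x by []; rewrite [N `&` W]NV => -[].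
have imX (z : 'rV[CC R]_(n + d)) :
    (psi @` W) z <-> E z /\ forall i, f i (lsubmx z) = 0.
  by rewrite (lm_image lmX).
have imS z : (phi @` M) z <-> D z /\ forall i, f i z = 0.
  by rewrite (lm_image lmS).
pose V' := slice (opensI (Opens oV) E) c.
have oQ : open (M `&` phi @^-1` V').
  apply: (lm_topology lmS _).2; first exact: subIsetl.
  by exists V' => //; exact: oset_open.
have Ex : E (psi x) by have [] := (imX (psi x)).1 (imageP _ Wx).
have Qx : (M `&` phi @^-1` V') (p x).
  by split; [exact: WM|rewrite /= psix; split].
apply: filterS (open_nbhs_nbhs (conj oQ Qx)) => s [Ms /= [Vs Es]].
have [_ fs] := (imS (phi s)).1 (imageP _ Ms).
(* The equations of the model of X only read the first block, where they hold because [s] lies in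
   [M]. Hence (phi s, c) is the coordinate vector of a point [y], and p y = s by injectivity of
   [phi] on [M]. *)
have /imX[y Wy psiy] : E (row_mx (phi s) c) /\
    forall i, f i (lsubmx (row_mx (phi s) c)) = 0.
  by split=> // i; rewrite row_mxKl.
have [Ny _] : (N `&` W) y by rewrite [N `&` W]NV; split=> //=; rewrite psiy.
exists y => //; apply: (lm_inj lmS) => //; first exact: WM.
by rewrite -psiphi// psiy row_mxKl.
Qed.

(** If [G] represents [g] near [p x], vanishing of the pull-back means G(lsubmx z) = sum_i a_i(z)
    f_i(lsubmx z) near [psi x]. Freezing the second block of [z] puts [G] itself in the ideal of the
    [f i]. Pointwise values would not do, since the structure sheaves may have nilpotents. *)
Lemma smooth_pull_inj (N : opens X) (M : opens S) (h : N `<=` p @^-1` M)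
    (g : rs_fun M) (x : X) : N x -> pull h g = 0 ->
  exists (M' : opens S) (k : M' `<=` M), M' (p x) /\ rs_res k g = 0.
Proof.
move=> Nx pg0.
have [n [d [k [M0 [D [f [phi [theta [W [E [psi [eta]]]]]]]]]]]] := hp x.
move=> [Wx WM lmS lmX [ED psiphi etaE]].
pose M1 := opensI M M0.
have M1x : M1 (p x) by split; [exact: (h _ Nx)|exact: WM].
have [M2 [M21 [V [G [M2x M2V holG gG]]]]] :=
  lm_surj lmS (rs_res (@opensIl _ M M0) g) (@opensIr _ M M0) M1x.
have M2M0 : M2 `<=` M0 := subset_trans M21 (@opensIr _ M M0).
pose N1 := opensI (opensI N W) (preim (rm_cont p) M2).
have N1M2 : N1 `<=` p @^-1` M2 := @opensIr _ _ _.
have N1N : N1 `<=` N by move=> y [[]].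
have N1W : N1 `<=` W by move=> y [[]].
have N1x : N1 x by [].
pose VX := preim (@continuous_lsubmx _ n d) V.
pose GX (z : 'rV[CC R]_(n + d)) : CC R := G (lsubmx z).
have N1VX : N1 `<=` psi @^-1` VX.
  by move=> y N1y /=; rewrite psiphi; [exact: M2V (N1M2 _ N1y)|exact: N1W].
have holGX : holomorphic_on VX GX.
  move=> z Vz; apply: differentiable_comp; last exact: holG.
  exact: differentiable_lsubmx.
have eta0 : eta N1 GX = 0.
  rewrite (etaE _ _ _ _ N1M2 N1W M2M0 M2V holG) -gG.
  rewrite (pull_res _ _ (fun y Ny => M21 _ (N1M2 y Ny))).
  rewrite (pull_res _ _ (subset_trans N1N h)).
  by rewrite -(res_pull N1N h _) pg0 rmorph0.
have [V' [a [V'x V'V hola GXE]]] := (lm_ker lmX N1W N1x N1VX holGX).1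
  (ex_intro _ N1 (ex_intro _ (@subset_refl _ N1)
    (conj N1x (etrans (congr1 (rs_res _) eta0) (rmorph0 _))))).
set c := rsubmx (psi x).
have psix : row_mx (phi (p x)) c = psi x by rewrite -psiphi// hsubmxK.
have [|M3 [M32 [M3x g0]]] := (lm_ker lmS M2M0 M2x M2V holG).2.
  (* The coefficients for [G] are those for [GX], restricted to the slice through [psi x]. *)
  exists (slice V' c), (fun i z => a i (row_mx z c)); split.
  - by rewrite /opens_mem /= psix.
  - move=> z /V'V [Vz /ED]; rewrite /= row_mxKl.
    by move: Vz; rewrite /= row_mxKl.
  - move=> i z Vz; apply: (@differentiable_comp _ _ _ _ (fun z => row_mx z c)).
      exact: differentiable_row_mx.
    exact: hola.
  - by move=> z Vz; have := GXE (row_mx z c) Vz; rewrite /GX row_mxKl => ->.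
exists M3, (subset_trans M32 (subset_trans M21 (@opensIl _ _ _))); split=> //.
rewrite -[RHS]g0 -gG.
rewrite (rs_res_comp _ _ (subset_trans M32 M21)); apply/esym.
exact: rs_res_comp.
Qed.

End Smooth.

(** * Derivations and germs *)

Section Derivations.
Variables (R : realType) (X : ringedSpace R).

Lemma deriv_eq (U : opens X) (D E : deriv U) :
  (forall (V : opens X) (h : V `<=` U) (g : rs_fun V), D V h g = E V h g) ->
  D = E.
Proof.
case: D E => [d d1 d2 d3 d4] [e e1 e2 e3 e4] /= de.
have {}de : d = e.
  by do 2![apply: functional_extensionality_dep => ?]; apply/funext => ?.
by subst e; congr Deriv; exact: Prop_irrelevance.
Qed.

Section Restriction.
Variables (U V : opens X) (h : V `<=` U) (D : deriv U).

Definition der_restr : deriv V.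
Proof.
exists (fun W k => D W (subset_trans k h)).
- by move=> *; exact: der_res.
- by move=> *; exact: der_add.
- by move=> *; exact: der_mul.
- by move=> *; exact: der_cst.
Defined.

End Restriction.

Section Operations.
Variables (U : opens X) (f : rs_fun U) (D E : deriv U).

Definition der_zero : deriv U.
Proof.
exists (fun V h g => 0).
- by move=> *; rewrite rmorph0.
- by move=> *; rewrite addr0.
- by move=> *; rewrite mul0r mulr0 addr0.
- by [].
Defined.

Definition der_lin : deriv U.
Proof.
exists (fun V h g => rs_res h f * D V h g + E V h g).
- move=> V W hV hW h g; rewrite !(der_res _ hV hW) rmorphD rmorphM.
  by rewrite (rs_res_comp h hW hV).
- by move=> V hV g g'; rewrite !der_add; ring.
- by move=> V hV g g'; rewrite !der_mul; ring.
- by move=> V hV c; rewrite !der_cst mulr0 addr0.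
Defined.

Definition der_comm : deriv U.
Proof.
exists (fun V h g => D V h (E V h g) - E V h (D V h g)).
- by move=> V W hV hW h g; rewrite !(der_res _ hV hW) rmorphB.
- by move=> V hV g g'; rewrite !der_add; ring.
- by move=> V hV g g'; rewrite !der_mul !der_add !der_mul; ring.
- move=> V hV c; rewrite !der_cst -(rmorph0 (rs_cst V)) !der_cst.
  by rewrite !rmorph0 subrr.
Defined.

End Operations.
End Derivations.

Section Germs.
Variables (Y : topologicalType) (F : opens Y -> Type).
Variable agree :
  forall N V V' : opens Y, N `<=` V -> N `<=` V' -> F V -> F V' -> Prop.
Hypothesis agree_refl : forall (V N : opens Y) (h h' : N `<=` V) (s : F V),
  agree h h' s s.
Hypothesis agree_sym : forall (V V' N : opens Y) (h : N `<=` V)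
  (h' : N `<=` V') (s : F V) (t : F V'), agree h h' s t -> agree h' h t s.
(** Transitivity incorporates restriction, because the two given agreements hold on different open
    sets and can only be composed on a common smaller one. *)
Hypothesis agree_trans : forall (V1 V2 V3 N N' M : opens Y)
  (h1 : N `<=` V1) (h2 : N `<=` V2) (k2 : N' `<=` V2) (k3 : N' `<=` V3)
  (l : M `<=` N) (l' : M `<=` N') (m1 : M `<=` V1) (m3 : M `<=` V3)
  (s : F V1) (t : F V2) (u : F V3),
  agree h1 h2 s t -> agree k2 k3 t u -> agree m1 m3 s u.

Lemma germ_self (y : Y) (V : opens Y) (s : F V) :
  V y -> germ agree y s (existT _ V s).
Proof. by move=> Vy; exists V, (@subset_refl _ _), (@subset_refl _ _). Qed.

Lemma germ_eq (y : Y) (V V' : opens Y) (s : F V) (t : F V') :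
  germ agree y s (existT _ V' t) -> germ agree y s = germ agree y t.
Proof.
move=> [N /= [h [h' [Ny st]]]].
apply/seteqP; split=> -[W u] [M /= [k [k' [My su]]]];
  exists (opensI N M); rewrite /=.
- exists (subset_trans (@opensIl _ N M) h'),
    (subset_trans (@opensIr _ N M) k'); split=> //.
  exact: (agree_trans (@opensIl _ N M) (@opensIr _ N M) _ _
    (agree_sym st) su).
- exists (subset_trans (@opensIl _ N M) h),
    (subset_trans (@opensIr _ N M) k'); split=> //.
  exact: (agree_trans (@opensIl _ N M) (@opensIr _ N M) _ _ st su).
Qed.

Section InverseImage.
Variables (X : topologicalType) (f : X -> Y) (U : opens X).

Lemma invimage_eq (v w : invimage agree f U) :
  (forall x, U x -> ii_germ v x = ii_germ w x) -> v = w.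
Proof.
case: v w => [v v1 v2] [w w1 w2] /= vw.
have {}vw : v = w.
  apply/funext => x; have [/vw//|Ux] := pselect (U x).
  by rewrite v1// w1.
by subst w; congr InvImage; exact: Prop_irrelevance.
Qed.

(** Gluing without choosing representatives: [P] tells which local sections may represent the result
    at a point. It serves both for sections of p^-1 T_S and for sections of the quotient of
    operators by A. *)
Lemma invimage_ex (P : X -> forall V : opens Y, F V -> Prop) :
  (forall x, U x -> exists (N : opens X) (V : opens Y) (s : F V),
    [/\ N x, N `<=` U, N `<=` f @^-1` V & forall y, N y -> P y V s]) ->
  (forall x (V V' : opens Y) (s : F V) (t : F V'), U x -> P x V s ->
    P x V' t -> germ agree (f x) s = germ agree (f x) t) ->
  exists w : invimage agree f U, forall x V (s : F V), U x -> P x V s ->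
    ii_germ w x = germ agree (f x) s.
Proof.
move=> Pex Pgerm.
pose w x : set {V : opens Y & F V} :=
  [set t | U x /\ exists V (s : F V), P x V s /\ germ agree (f x) s t].
have wE x V (s : F V) : U x -> P x V s -> w x = germ agree (f x) s.
  move=> Ux Ps; apply/seteqP; split=> [t [_ [V' [s' [Ps' s't]]]]|t st].
    by rewrite (Pgerm _ _ _ s s').
  by split=> //; exists V, s.
have w_out x : ~ U x -> w x = set0.
  by move=> Ux; apply/seteqP; split=> // t [].
have w_loc x : U x -> exists (N : opens X) (V : opens Y) (s : F V),
    [/\ N x, N `<=` U, N `<=` f @^-1` V
      & forall y, N y -> w y = germ agree (f y) s].
  move=> /Pex[N [V [s [Nx NU NV Ps]]]]; exists N, V, s; split=> // y Ny.
  by apply: wE; [exact: NU|exact: Ps].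
by exists (InvImage w_out w_loc).
Qed.

End InverseImage.
End Germs.

(** * First order operators on a family of Lie algebroids *)

(** In a commutator of first order operators or of derivations, [b] and [c] are the cross terms,
    where each of the two operators acts on a different factor; they cancel. *)
Lemma addr_cross (V : zmodType) (a b c d e f : V) :
  a + b + (c + d) - (e + c + (b + f)) = a - e + (d - f).
Proof.
rewrite [a + b + _](AC (2*2) ((1*4)*(2*3))).
rewrite [e + c + _](AC (2*2) ((1*4)*(3*2))) /=.
by rewrite opprD [LHS]addrACA subrr addr0 opprD [LHS]addrACA.
Qed.

Section Operators.
Variables (R : realType) (X S : ringedSpace R) (p : rsMorphism X S).
Variable A : lie_family p.

Lemma om_res_comp (U V W : opens X) (h : U `<=` V) (k : V `<=` W)
  (l : U `<=` W) (s : A W) : om_res h (om_res k s) = om_res l s.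
Proof. by have [_ + _] := om_sheaf A; exact. Qed.

Lemma om_resN (U V : opens X) (h : U `<=` V) (s : A V) :
  om_res h (- s) = - om_res h s.
Proof. by rewrite -scaleN1r om_res_scale rmorphN1 scaleN1r. Qed.

Section Bracket.
Variable U : opens X.
Local Notation "[: s , t ]" := (lf_bracket A U s t).

Lemma lf_bracketDl (s s' t : A U) : [: s + s', t] = [: s, t] + [: s', t].
Proof.
have := la_bilinear_l (lf_axioms A) 1 s s' t.
by rewrite rmorph1 !scale1r.
Qed.

Lemma lf_bracketDr (s t t' : A U) : [: s, t + t'] = [: s, t] + [: s, t'].
Proof.
have := la_bilinear_r (lf_axioms A) 1 s t t'.
by rewrite rmorph1 !scale1r.
Qed.

Lemma lf_bracket0l (t : A U) : [: 0, t] = 0.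
Proof. by apply: (addrI [: 0, t]); rewrite -lf_bracketDl !addr0. Qed.

Lemma lf_bracketNl (s t : A U) : [: - s, t] = - [: s, t].
Proof.
by apply: (addrI [: s, t]); rewrite -lf_bracketDl !subrr lf_bracket0l.
Qed.

Lemma lf_bracketNr (s t : A U) : [: s, - t] = - [: s, t].
Proof.
by rewrite (la_antisym (lf_axioms A)) lf_bracketNl -(la_antisym (lf_axioms A)).
Qed.

(** In other words, the symbol of the inner derivation {s, -} is the anchor of [s]. *)
Lemma lf_bracketZr (k : U `<=` U) (g : rs_fun U) (s t : A U) :
  [: s, g *: t] = g *: [: s, t] + lf_anchor s U k g *: t.
Proof.
rewrite (la_antisym (lf_axioms A)) (la_leibniz (lf_axioms A) k).
by rewrite opprB addrC -scalerN -(la_antisym (lf_axioms A)).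
Qed.

End Bracket.

Section Endo.
Variables (U : opens X) (psi : endo A U) (V : opens X) (h : V `<=` U).

Lemma endoD (s t : A V) : psi V h (s + t) = psi V h s + psi V h t.
Proof. by have := endo_linear psi h 1 s t; rewrite rmorph1 !scale1r. Qed.

Lemma endo0 : psi V h 0 = 0.
Proof. by apply: (addrI (psi V h 0)); rewrite -endoD !addr0. Qed.

Lemma endoN (s : A V) : psi V h (- s) = - psi V h s.
Proof. by apply: (addrI (psi V h s)); rewrite -endoD !subrr endo0. Qed.

Lemma endoZ_cst (c : CC R) (s : A V) :
  psi V h (rs_cst V c *: s) = rs_cst V c *: psi V h s.
Proof. by have := endo_linear psi h c s 0; rewrite endo0 !addr0. Qed.

End Endo.

Lemma endo_eq (U : opens X) (psi phi : endo A U) :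
  (forall (V : opens X) (h : V `<=` U) (s : A V), psi V h s = phi V h s) ->
  psi = phi.
Proof.
case: psi phi => [d d1 d2] [e e1 e2] /= de.
have {}de : d = e.
  by do 2![apply: functional_extensionality_dep => ?]; apply/funext => ?.
by subst e; congr Endo; exact: Prop_irrelevance.
Qed.

Lemma lie_diffop_eq (U : opens X) (psi phi : lie_diffop A U) :
  (forall (V : opens X) (h : V `<=` U) (s : A V), psi V h s = phi V h s) ->
  psi = phi.
Proof.
case: psi phi => [d d1 d2] [e e1 e2] /= /endo_eq de.
by subst e; congr LieDiffop; exact: Prop_irrelevance.
Qed.

Section Restriction.
Variables (U N : opens X) (h : N `<=` U).

Definition endo_restr (psi : endo A U) : endo A N.
Proof.
exists (fun W k => psi W (subset_trans k h)).
- by move=> *; exact: endo_res.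
- by move=> *; exact: endo_linear.
Defined.

Lemma lie_derivation_restr (psi : endo A U) :
  lie_derivation psi -> lie_derivation (endo_restr psi).
Proof. by move=> psiL V hV s t; exact: psiL. Qed.

Lemma diffop1_restr (psi : endo A U) :
  diffop1 psi -> diffop1 (endo_restr psi).
Proof.
move=> psi1 V hV g; have [f psif] := psi1 V (subset_trans hV h) g.
by exists f => W hW k s; exact: psif.
Qed.

Definition ld_restr (psi : lie_diffop A U) : lie_diffop A N :=
  LieDiffop (lie_derivation_restr (ld_lie psi)) (diffop1_restr (ld_order psi)).

Lemma is_symbol_restr (psi : lie_diffop A U) (D : deriv U) :
  is_symbol psi D -> is_symbol (ld_restr psi) (der_restr h D).
Proof. by move=> psiD V hV g s; exact: psiD. Qed.

End Restriction.

Section Zero.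
Variable U : opens X.

Definition endo_zero : endo A U.
Proof.
exists (fun W k s => 0).
- move=> V W hV hW h s; rewrite -[in RHS](scale0r (0 : A W)).
  by rewrite om_res_scale rmorph0 scale0r.
- by move=> *; rewrite scaler0 addr0.
Defined.

Lemma lie_derivation_zero : lie_derivation endo_zero.
Proof.
move=> V hV s t; rewrite /= lf_bracket0l (la_antisym (lf_axioms A)).
by rewrite lf_bracket0l oppr0 addr0.
Qed.

Lemma is_symbol_zero : is_symbol endo_zero (der_zero U).
Proof. by move=> V hV g s; rewrite /= scaler0 scale0r subrr. Qed.

Lemma diffop1_zero : diffop1 endo_zero.
Proof.
move=> V hV g; exists 0 => W hW h s.
by rewrite /= rmorph0 scaler0 scale0r subrr.
Qed.

Definition ld_zero : lie_diffop A U :=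
  LieDiffop lie_derivation_zero diffop1_zero.

End Zero.

Section Linear.
Variables (U : opens X) (V : opens S) (h : U `<=` p @^-1` V) (g : rs_fun V).

(** The coefficient comes from S because the bracket is linear over pulled back functions, so that g
    psi + phi is again a Lie derivation; for a general function on X the anchor would contribute
    extra terms. *)
Definition endo_lin (psi phi : endo A U) : endo A U.
Proof.
exists (fun W k s => pull (subset_trans k h) g *: psi W k s + phi W k s).
- move=> W W' hW hW' k s; rewrite !(endo_res _ hW hW') om_res_add om_res_scale.
  by rewrite (res_pull k _ (subset_trans hW h)).
- move=> W hW c s t; rewrite !endo_linear !scalerDr !scalerA.
  by rewrite (mulrC (pull _ _)) addrACA.
Defined.

Lemma lie_derivation_lin (psi phi : endo A U) :
  lie_derivation psi -> lie_derivation phi -> lie_derivation (endo_lin psi phi).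
Proof.
move=> psiL phiL W hW s t /=; rewrite psiL phiL lf_bracketDl lf_bracketDr.
by rewrite lf_bilinear_l lf_bilinear_r scalerDr addrACA.
Qed.

Lemma diffop1_lin (psi phi : endo A U) :
  diffop1 psi -> diffop1 phi -> diffop1 (endo_lin psi phi).
Proof.
move=> psi1 phi1 W hW f.
have [a psia] := psi1 W hW f; have [b phib] := phi1 W hW f.
exists (pull (subset_trans hW h) g * a + b) => W' hW' k s /=.
rewrite rmorphD rmorphM (res_pull k _ (subset_trans hW' h)).
rewrite scalerDl -scalerA -psia -phib !scalerDr scalerN !scalerA opprD.
by rewrite (mulrC (rs_res k f)) addrACA.
Qed.

Definition ld_lin (psi phi : lie_diffop A U) : lie_diffop A U :=
  LieDiffop (lie_derivation_lin (ld_lie psi) (ld_lie phi))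
    (diffop1_lin (ld_order psi) (ld_order phi)).

Lemma is_symbol_lin (psi phi : lie_diffop A U) (D E : deriv U) :
  is_symbol psi D -> is_symbol phi E ->
  is_symbol (ld_lin psi phi) (der_lin (pull h g) D E).
Proof.
move=> psiD phiE W hW f s /=; rewrite (res_pull hW _ (subset_trans hW h)).
rewrite scalerDl -scalerA -psiD -phiE !scalerDr scalerN !scalerA opprD.
by rewrite (mulrC f) addrACA.
Qed.

End Linear.

Section Commutator.
Variable U : opens X.

Definition endo_comm (psi phi : endo A U) : endo A U.
Proof.
exists (fun W k s => psi W k (phi W k s) - phi W k (psi W k s)).
- by move=> V W hV hW h s; rewrite !(endo_res _ hV hW) om_res_add om_resN.
- move=> W hW c s t; rewrite !endo_linear opprD addrACA.
  by rewrite scalerDr scalerN.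
Defined.

Lemma lie_derivation_comm (psi phi : endo A U) :
  lie_derivation psi -> lie_derivation phi ->
  lie_derivation (endo_comm psi phi).
Proof.
move=> psiL phiL W hW s t /=.
rewrite psiL phiL !endoD !psiL !phiL !lf_bracketDl !lf_bracketDr.
rewrite lf_bracketNl lf_bracketNr.
exact: addr_cross.
Qed.

Lemma diffop1_comm (psi phi : endo A U) :
  diffop1 psi -> diffop1 phi -> diffop1 (endo_comm psi phi).
Proof.
move=> psi1 phi1 W hW f.
have [a psia] := psi1 W hW f; have [b phib] := phi1 W hW f.
(* The symbol of the commutator is the commutator of the symbols: with a = psi f and b = phi f, its
   value at [f] is psi b - phi a. *)
have [c psic] := psi1 W hW b; have [d phid] := phi1 W hW a.
exists (c - d) => W' hW' k s /=.
have {}psia t := canRL (subrK _) (psia W' hW' k t).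
have {}psic t := canRL (subrK _) (psic W' hW' k t).
have {}phib t := canRL (subrK _) (phib W' hW' k t).
have {}phid t := canRL (subrK _) (phid W' hW' k t).
rewrite psia phib !endoD psia phib psic phid rmorphB scalerDl scaleNr.
by rewrite scalerDr scalerN addr_cross addrK.
Qed.

Definition ld_comm (psi phi : lie_diffop A U) : lie_diffop A U :=
  LieDiffop (lie_derivation_comm (ld_lie psi) (ld_lie phi))
    (diffop1_comm (ld_order psi) (ld_order phi)).

Lemma is_symbol_comm (psi phi : lie_diffop A U) (D E : deriv U) :
  is_symbol psi D -> is_symbol phi E ->
  is_symbol (ld_comm psi phi) (der_comm D E).
Proof.
move=> psiD phiE W hW f s /=.
have {}psiD g t := canRL (subrK _) (psiD W hW g t).
have {}phiE g t := canRL (subrK _) (phiE W hW g t).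
rewrite psiD phiE !endoD !psiD !phiE scalerDl scaleNr.
by rewrite scalerDr scalerN addr_cross addrK.
Qed.

End Commutator.
End Operators.

(** * Equality of operators modulo inner derivations *)

Lemma addr_comm_cross (V : zmodType) (x y z u v w : V) :
  x + (y + z) - (u + (v + w)) - (z - w) = y - v - (u - x).
Proof.
rewrite [x + _](AC (1*2) ((2*1)*3)) [u + _](AC (1*2) ((2*1)*3)) /= opprD.
by rewrite [X in X - _ = _]addrACA addrK opprB [RHS]addrACA -opprD.
Qed.

Section Agreement.
Variables (R : realType) (X S : ringedSpace R) (p : rsMorphism X S).
Variable A : lie_family p.

Lemma op_agree_refl (V N : opens X) (h h' : N `<=` V) (psi : lie_diffop A V) :
  op_agree h h' psi psi.
Proof.
exists 0 => W k kV kV' s; rewrite (Prop_irrelevance kV kV') subrr.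
have -> : om_res k 0 = 0 :> A W.
  by apply: (addrI (om_res k 0)); rewrite -om_res_add !addr0.
by rewrite lf_bracket0l.
Qed.

Lemma op_agree_sym (V V' N : opens X) (h : N `<=` V) (h' : N `<=` V')
    (psi : lie_diffop A V) (psi' : lie_diffop A V') :
  op_agree h h' psi psi' -> op_agree h' h psi' psi.
Proof.
move=> [al psiE]; exists (- al) => W k kV kV' s.
by rewrite om_resN lf_bracketNl -(psiE _ _ kV' kV) opprB.
Qed.

Lemma op_agree_trans (V1 V2 V3 N N' M : opens X)
    (h1 : N `<=` V1) (h2 : N `<=` V2) (k2 : N' `<=` V2) (k3 : N' `<=` V3)
    (l : M `<=` N) (l' : M `<=` N') (m1 : M `<=` V1) (m3 : M `<=` V3)
    (psi1 : lie_diffop A V1) (psi2 : lie_diffop A V2)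
    (psi3 : lie_diffop A V3) :
  op_agree h1 h2 psi1 psi2 -> op_agree k2 k3 psi2 psi3 ->
  op_agree m1 m3 psi1 psi3.
Proof.
move=> [al psiE] [be psiE']; exists (om_res l al + om_res l' be).
move=> W k kV kV' s; have k2V := subset_trans (subset_trans k l) h2.
rewrite om_res_add (om_res_comp _ _ (subset_trans k l)).
rewrite (om_res_comp _ _ (subset_trans k l')) lf_bracketDl.
by rewrite -(psiE _ _ kV k2V) -(psiE' _ _ k2V kV') subrKA.
Qed.

Lemma op_agree_lin (U U' N N' M : opens X) (V : opens S)
    (hU : U `<=` p @^-1` V) (hU' : U' `<=` p @^-1` V) (g : rs_fun V)
    (h : N `<=` U) (h' : N `<=` U') (k : N' `<=` U) (k' : N' `<=` U')
    (l : M `<=` N) (l' : M `<=` N') (m : M `<=` U) (m' : M `<=` U')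
    (psi phi : lie_diffop A U) (psi' phi' : lie_diffop A U') :
  op_agree h h' psi psi' -> op_agree k k' phi phi' ->
  op_agree m m' (ld_lin hU g psi phi) (ld_lin hU' g psi' phi').
Proof.
move=> [al psiE] [be phiE].
have hM : M `<=` p @^-1` V := subset_trans m hU.
exists (pull hM g *: om_res l al + om_res l' be) => W j j1 j2 s /=.
have hW := subset_trans j hM.
rewrite (Prop_irrelevance (subset_trans j1 hU) hW).
rewrite (Prop_irrelevance (subset_trans j2 hU') hW).
rewrite om_res_add om_res_scale (om_res_comp _ _ (subset_trans j l)).
rewrite (om_res_comp _ _ (subset_trans j l')) (res_pull _ _ hW).
rewrite lf_bracketDl lf_bilinear_l -(psiE _ _ j1 j2) -(phiE _ _ j1 j2).
by rewrite opprD addrACA scalerBr.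
Qed.

(** Inner derivations form an ideal among Lie derivations, by [psi, {al, -}] = {psi al, -}. *)
Lemma op_agree_comm (U U' N N' M : opens X)
    (h : N `<=` U) (h' : N `<=` U') (k : N' `<=` U) (k' : N' `<=` U')
    (l : M `<=` N) (l' : M `<=` N') (m : M `<=` U) (m' : M `<=` U')
    (psi phi : lie_diffop A U) (psi' phi' : lie_diffop A U') :
  op_agree h h' psi psi' -> op_agree k k' phi phi' ->
  op_agree m m' (ld_comm psi phi) (ld_comm psi' phi').
Proof.
move=> [al psiE] [be phiE].
(* From [psi, phi] - [psi', phi'] = [psi - psi', phi] + [psi', phi - phi']. Using [phi] rather than
   [phi'] on [al] absorbs the term in {al, be}. *)
exists (psi' M m' (om_res l' be) - phi M m (om_res l al)).
move=> W j j1 j2 s /=.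
rewrite om_res_add om_resN -(endo_res psi' j2 m') -(endo_res phi j1 m).
rewrite (om_res_comp _ _ (subset_trans j l)).
rewrite (om_res_comp _ _ (subset_trans j l')).
have {}psiE t := canRL (subrK _) (psiE _ (subset_trans j l) j1 j2 t).
have {}phiE t := canRL (subrK _) (phiE _ (subset_trans j l') j1 j2 t).
have := ld_lie psi' j2 (om_res (subset_trans j l') be) s.
have := ld_lie phi j1 (om_res (subset_trans j l) al) s.
move=> /esym/(canRL (addrK _)) phiL /esym/(canRL (addrK _)) psiL.
rewrite lf_bracketDl lf_bracketNl phiL psiL.
rewrite !psiE !endoD (phiE (psi' W j2 s)) (phiE s) endoD.
exact: addr_comm_cross.
Qed.

Hypothesis hA : faithful_sheaf A.

(* The symbols of operators which agree modulo inner derivations differ by the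
   anchor of a section of [A], which is vertical. *)
Lemma op_agree_symbol (V V' N : opens X) (h : N `<=` V) (h' : N `<=` V')
    (psi : lie_diffop A V) (psi' : lie_diffop A V') (D : deriv V)
    (D' : deriv V') :
  op_agree h h' psi psi' -> is_symbol psi D -> is_symbol psi' D' ->
  forall (W : opens X) (k : W `<=` N) (kV : W `<=` V) (kV' : W `<=` V')
    (M : opens S) (j : W `<=` p @^-1` M) (g : rs_fun M),
    D W kV (pull j g) = D' W kV' (pull j g).
Proof.
move=> [al psiE] psiD psiD' W k kV kV' M j g; apply/eqP; rewrite -subr_eq0.
apply/eqP; apply: hA => W' l s; set f := pull j g.
pose kW := subset_trans l kV; pose kW' := subset_trans l kV'.
rewrite rmorphB scalerBl -(der_res D kW kV) -(der_res D' kW' kV').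
rewrite -psiD -psiD'.
have {}psiE t := canRL (subrK _) (psiE _ (subset_trans l k) kW kW' t).
rewrite !psiE (lf_bracketZr (@subset_refl _ _)).
have -> : lf_anchor (om_res (subset_trans l k) al) W' (@subset_refl _ _)
    (rs_res l f) = 0.
  by rewrite (res_pull _ _ (subset_trans l j)) lf_vertical.
by rewrite scale0r addr0 scalerDr opprD addrACA subrr add0r subrr.
Qed.

End Agreement.

(** * Liftings of vector fields *)

Section DerivationGerms.
Variables (R : realType) (S : ringedSpace R).

Lemma deriv_agree_refl (V N : opens S) (h h' : N `<=` V) (v : deriv V) :
  deriv_agree h h' v v.
Proof. by move=> W k kV kV' g; rewrite (Prop_irrelevance kV kV'). Qed.

Lemma deriv_agree_sym (V V' N : opens S) (h : N `<=` V) (h' : N `<=` V')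
    (v : deriv V) (v' : deriv V') :
  deriv_agree h h' v v' -> deriv_agree h' h v' v.
Proof. by move=> vE W k kV kV' g; rewrite (vE W k kV' kV). Qed.

Lemma deriv_agree_trans (V1 V2 V3 N N' M : opens S)
    (h1 : N `<=` V1) (h2 : N `<=` V2) (k2 : N' `<=` V2) (k3 : N' `<=` V3)
    (l : M `<=` N) (l' : M `<=` N') (m1 : M `<=` V1) (m3 : M `<=` V3)
    (v1 : deriv V1) (v2 : deriv V2) (v3 : deriv V3) :
  deriv_agree h1 h2 v1 v2 -> deriv_agree k2 k3 v2 v3 ->
  deriv_agree m1 m3 v1 v3.
Proof.
move=> vE vE' W k kV kV' g; have kN := subset_trans k l.
have kN' := subset_trans k l'; have k2V := subset_trans kN h2.
by rewrite (vE W kN kV k2V) (vE' W kN' k2V kV').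
Qed.

Definition deriv_germ_eq := germ_eq (@deriv_agree_sym) (@deriv_agree_trans).

End DerivationGerms.

Section Lifts.
Variables (R : realType) (X S : ringedSpace R) (p : rsMorphism X S).

(** The form of [projects] valid on the whole domain of [D]: it is what linear combinations and
    commutators preserve without shrinking, and [projects] becomes [lifts] after restriction near
    the point. *)
Definition lifts (N : opens X) (D : deriv N) (V : opens S) (v : deriv V) :
    Prop :=
  N `<=` p @^-1` V /\
  forall (W : opens X) (kN : W `<=` N) (M : opens S) (kV : M `<=` V)
    (h : W `<=` p @^-1` M) (g : rs_fun M),
    D W kN (pull h g) = pull h (v M kV g).

Lemma projects_lifts (x : X) (U : opens X) (D : deriv U) (V : opens S)
    (v : deriv V) : projects p x D v ->
  exists (N : opens X) (h : N `<=` U), N x /\ lifts (der_restr h D) v.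
Proof.
move=> [N [Nx NU NV Dv]]; exists N, NU; split=> //; split=> // W kN M kV h g.
exact: Dv.
Qed.

Lemma lifts_projects (x : X) (N : opens X) (D : deriv N) (V : opens S)
  (v : deriv V) : N x -> lifts D v -> projects p x D v.
Proof. by move=> Nx [NV Dv]; exists N; split=> // *; exact: Dv. Qed.

Lemma lifts_restr (N N' : opens X) (V V' : opens S) (h : N' `<=` N)
    (k : V' `<=` V) (D : deriv N) (v : deriv V) : N' `<=` p @^-1` V' ->
  lifts D v -> lifts (der_restr h D) (der_restr k v).
Proof. by move=> NV' [NV Dv]; split=> // W kN M kV l g; exact: Dv. Qed.

Lemma lifts_zero (N : opens X) (V : opens S) : N `<=` p @^-1` V ->
  lifts (der_zero N) (der_zero V).
Proof. by move=> NV; split=> // W kN M kV h g; rewrite /pull !rmorph0. Qed.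

Lemma lifts_lin (N : opens X) (V V' : opens S) (h : N `<=` p @^-1` V)
    (k : V' `<=` V) (g : rs_fun V) (D E : deriv N) (v w : deriv V') :
  lifts D v -> lifts E w ->
  lifts (der_lin (pull h g) D E) (der_lin (rs_res k g) v w).
Proof.
move=> [NV Dv] [_ Ew]; split=> // W kN M kV l f /=.
rewrite (Dv _ _ _ kV) (Ew _ _ _ kV) (res_pull _ _ (subset_trans kN h)).
rewrite -(pull_res k (fun y Wy => kV _ (l y Wy))) -(pull_res kV l).
by rewrite /pull !rmorphD !rmorphM.
Qed.

Lemma lifts_comm (N : opens X) (V : opens S) (D E : deriv N) (v w : deriv V) :
  lifts D v -> lifts E w -> lifts (der_comm D E) (der_comm v w).
Proof.
move=> [NV Dv] [_ Ew]; split=> // W kN M kV l f /=.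
rewrite (Ew _ _ _ kV) !(Dv _ _ _ kV) (Ew _ _ _ kV).
by rewrite /pull !rmorphB.
Qed.

Lemma projects_of_germ (x : X) (U : opens X) (D : deriv U) (V V' : opens S)
    (v : deriv V) (v' : deriv V') :
  germ (@deriv_agree R S) (p x) v (existT _ V' v') ->
  projects p x D v -> projects p x D v'.
Proof.
move=> [P /= [h [h' [Px vv']]]] [N [Nx NU NV Dv]].
exists (opensI N (preim (rm_cont p) P)); split=> //.
- by move=> y [/NU].
- by move=> y [_ /h'].
move=> W kU M kV l g WN.
(* The two fields are only known to agree on [P], which need not contain [M]. Since [p] maps [W]
   into [P], restricting [g] to [M'] leaves its pull-back to [W] unchanged. *)
pose M' := opensI M P; pose M'M : M' `<=` M := @opensIl _ _ _.
have l' : W `<=` p @^-1` M'.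
  by move=> y Wy; split; [exact: l|have [] := WN y Wy].
have M'V : M' `<=` V := subset_trans (@opensIr _ _ _) h.
rewrite -!(pull_res M'M l') (Dv W kU M' M'V); last by move=> y /WN[].
rewrite (vv' M' (@opensIr _ _ _) M'V (subset_trans M'M kV)).
by rewrite (der_res v' _ kV).
Qed.

Lemma projects_germ (hp : smooth p) (x : X) (U : opens X) (D : deriv U)
    (V V' : opens S) (v : deriv V) (v' : deriv V') :
  projects p x D v -> projects p x D v' ->
  germ (@deriv_agree R S) (p x) v = germ (@deriv_agree R S) (p x) v'.
Proof.
move=> [N [Nx NU NV Dv]] [N' [N'x N'U N'V Dv']]; apply: deriv_germ_eq => /=.
(* On the image of N and N' intersected, every point has a preimage at which both fields have the
   same pull-back, so injectivity on germs applies throughout. *)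
pose P := Opens (smooth_open hp (opensI N N')).
have PV : P `<=` V by move=> _ [y [/NV Vy _] <-].
have PV' : P `<=` V' by move=> _ [y [_ /N'V Vy] <-].
exists P, PV, PV'; split; first by exists x.
move=> W k kV kV' g; apply/eqP; rewrite -subr_eq0; apply/eqP.
apply: rs_fun_local_eq0 => s Ws; have [y [Ny N'y] ys] := k s Ws.
pose N0 := opensI (opensI N N') (preim (rm_cont p) W).
have h : N0 `<=` p @^-1` W by move=> z [].
have N0y : N0 y by split=> //; rewrite /= ys.
have NU0 : N0 `<=` U by move=> z [[/NU]].
rewrite -ys; apply: (smooth_pull_inj hp (h := h)) => //.
rewrite /pull !rmorphB -/(pull h _) -/(pull h (v' _ _ _)).
rewrite -(Dv _ NU0); last by move=> z [[]].
by rewrite -(Dv' _ NU0) ?subrr// => z [[]].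
Qed.

End Lifts.

(** * Sections of u(A) *)

Section Sections.
Variables (R : realType) (X S : ringedSpace R) (p : rsMorphism X S).
Variable A : lie_family p.

Definition op_germ_eq :=
  germ_eq (@op_agree_sym _ _ _ _ A) (@op_agree_trans _ _ _ _ A).

Section Representatives.
Variable U : opens X.
Implicit Types q r : usec A U.

Lemma urep_mem q x (N : opens X) (psi : lie_diffop A N) :
  urep q x psi -> U x.
Proof.
move=> qpsi; apply: contrapT => Ux.
by move: qpsi; rewrite /urep (ii_out (sval q) Ux).
Qed.

Lemma urep_germ q x (N : opens X) (psi : lie_diffop A N) :
  urep q x psi -> ii_germ (sval q) x = germ (@op_agree _ _ _ _ A) x psi.
Proof.
move=> qpsi; have Ux := urep_mem qpsi.
have [M [V [s [Mx _ _ qE]]]] := ii_loc (sval q) Ux.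
by move: qpsi; rewrite /urep (qE _ Mx) => /op_germ_eq ->.
Qed.

Lemma urep_agree q x (N N' : opens X) (psi : lie_diffop A N)
    (psi' : lie_diffop A N') : urep q x psi -> urep q x psi' ->
  exists (M : opens X) (h : M `<=` N) (h' : M `<=` N'),
    M x /\ op_agree h h' psi psi'.
Proof. by move=> /urep_germ qE; rewrite /urep qE. Qed.

Lemma urep_of_germ q x (N N' : opens X) (psi : lie_diffop A N)
    (psi' : lie_diffop A N') : urep q x psi ->
  germ (@op_agree _ _ _ _ A) x psi (existT _ N' psi') -> urep q x psi'.
Proof. by move=> /urep_germ qE; rewrite /urep qE. Qed.

Lemma urep_restr q x (N N' : opens X) (h : N' `<=` N)
  (psi : lie_diffop A N) : N' x -> urep q x psi -> urep q x (ld_restr h psi).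
Proof.
move=> N'x qpsi; apply: urep_of_germ qpsi _.
exists N', h, (@subset_refl _ _); split=> //=.
have [al psiE] := op_agree_refl h h psi.
by exists al => W k kV kV' s; exact: psiE.
Qed.

Lemma usec_eq q r :
  (forall x, U x -> exists (N : opens X) (psi : lie_diffop A N),
    urep q x psi /\ urep r x psi) -> q = r.
Proof.
move=> qr; have {}qr : sval q = sval r.
  apply: invimage_eq => x /qr[N [psi [/urep_germ -> /urep_germ ->]]] //.
case: q r qr => [q qP] [r rP] /= qr; subst r.
by congr exist; exact: Prop_irrelevance.
Qed.

Lemma usec_chart q x : U x ->
  exists (N : opens X) (psi : lie_diffop A N) (D : deriv N) (V : opens S)
    (v : deriv V),
    [/\ N x, N `<=` U, is_symbol psi D, lifts p D v
      & forall y, N y -> urep q y psi].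
Proof.
move=> Ux; have [N1 [psi [D [V [v [qpsi psiD _ Dv]]]]]] := svalP q x Ux.
have [N2 [V2 [s [N2x N2U _ qE]]]] := ii_loc (sval q) Ux.
have [N3 [h3 [N3x Dv3]]] := projects_lifts Dv.
move: (qpsi); rewrite (qE _ N2x) => -[N4 /= [h4 [h4' [N4x spsi]]]].
pose N := opensI (opensI N2 N3) N4.
have NN3 : N `<=` N3 by move=> y [[]].
have NN1 : N `<=` N1 := subset_trans NN3 h3.
have [N3V _] := Dv3.
exists N, (ld_restr NN1 psi), (der_restr NN3 (der_restr h3 D)), V,
  (der_restr (@subset_refl _ _) v); split=> //.
- by move=> y [[/N2U]].
- move=> W hW g t /=; rewrite (Prop_irrelevance (subset_trans _ h3)
    (subset_trans hW NN1)).
  exact: psiD.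
- by apply: lifts_restr => //; exact: subset_trans NN3 N3V.
- move=> y Ny; apply: urep_restr => //.
  rewrite /urep qE; last by case: Ny => [[]].
  by exists N4, h4, h4'; split=> //; case: Ny.
Qed.

(** Beyond [invimage_ex], the local operators come with a symbol and a lifted field, which is what
    places the glued section of the quotient in u(A). *)
Lemma usec_ex (P : X -> forall N : opens X, lie_diffop A N -> Prop) :
  (forall x, U x -> exists (N : opens X) (psi : lie_diffop A N) (D : deriv N)
    (V : opens S) (v : deriv V),
    [/\ N x, N `<=` U, is_symbol psi D, lifts p D v
      & forall y, N y -> P y N psi]) ->
  (forall x (N : opens X) (psi : lie_diffop A N), P x N psi -> N x) ->
  (forall x (N N' : opens X) (psi : lie_diffop A N) (psi' : lie_diffop A N'),
    U x -> P x N psi -> P x N' psi' ->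
    germ (@op_agree _ _ _ _ A) x psi (existT _ N' psi')) ->
  exists q, forall x (N : opens X) (psi : lie_diffop A N), U x -> P x N psi ->
    urep q x psi.
Proof.
move=> Pex Pmem Pgerm.
have [|x N N' psi psi' Ux Ppsi Ppsi'|q qE] := @invimage_ex _ _
    (@op_agree _ _ _ _ A) _ id U P.
- move=> x /Pex[N [psi [D [V [v [Nx NU psiD Dv Ppsi]]]]]].
  by exists N, N, psi; split.
- by apply: op_germ_eq; exact: Pgerm.
have qP x (N : opens X) (psi : lie_diffop A N) : U x -> P x N psi ->
    ii_germ q x (existT _ N psi).
  move=> Ux Ppsi; rewrite (qE _ _ _ Ux Ppsi).
  apply: germ_self; last exact: Pmem Ppsi.
  exact: op_agree_refl.
have qu : in_u q.
  move=> x Ux; have [N [psi [D [V [v [Nx _ psiD Dv Ppsi]]]]]] := Pex x Ux.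
  exists N, psi, D, V, v; split=> //; first exact: (qP _ _ _ Ux (Ppsi x Nx)).
    by case: Dv => + _; exact.
  exact: lifts_projects Dv.
by exists (exist _ q qu) => x N psi Ux Ppsi; exact: qP.
Qed.

End Representatives.

Lemma usec_res_ex (U W : opens X) (h : U `<=` W) (q : usec A W) :
  exists r : usec A U, forall x (N : opens X) (psi : lie_diffop A N),
    U x -> urep q x psi -> N x -> urep r x psi.
Proof.
have [x Ux|x N psi []//|x N N' psi psi' Ux [_ qpsi] [_ qpsi']|r rE] :=
    @usec_ex U (fun x N psi => N x /\ urep q x psi).
- have [N [psi [D [V [v [Nx NW psiD Dv qpsi]]]]]] := usec_chart q (h _ Ux).
  pose M := opensI N U; pose MN : M `<=` N := @opensIl _ _ _.
  exists M, (ld_restr MN psi), (der_restr MN D), V,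
    (der_restr (@subset_refl _ _) v); split=> //.
  + by move=> y [].
  + exact: is_symbol_restr.
  + by apply: lifts_restr => //; case: Dv => NV _; exact: subset_trans NV.
  + move=> y My; split=> //; apply: urep_restr => //.
    by apply: qpsi; case: My.
- by rewrite -(urep_germ qpsi).
by exists r => x N psi Ux qpsi Nx; apply: rE.
Qed.

(** Common source of the linear operations and of the bracket: [Phi] must descend modulo inner
    derivations and keep symbols liftable from S. The fields are taken on V' inside [V] so that a
    coefficient in O_S(V) can be restricted to their domain. *)
Lemma usec_op2_ex (V : opens S)
    (Phi : forall N : opens X, N `<=` p @^-1` V ->
      lie_diffop A N -> lie_diffop A N -> lie_diffop A N) :
  (forall (U U' N N' M : opens X) (hU : U `<=` p @^-1` V)
      (hU' : U' `<=` p @^-1` V) (h : N `<=` U) (h' : N `<=` U')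
      (k : N' `<=` U) (k' : N' `<=` U') (l : M `<=` N) (l' : M `<=` N')
      (m : M `<=` U) (m' : M `<=` U')
      (psi phi : lie_diffop A U) (psi' phi' : lie_diffop A U'),
    op_agree h h' psi psi' -> op_agree k k' phi phi' ->
    op_agree m m' (Phi U hU psi phi) (Phi U' hU' psi' phi')) ->
  (forall (N : opens X) (hN : N `<=` p @^-1` V) (psi phi : lie_diffop A N)
      (D E : deriv N) (V' : opens S) (v w : deriv V'), V' `<=` V ->
    is_symbol psi D -> is_symbol phi E -> lifts p D v -> lifts p E w ->
    exists (D' : deriv N) (v' : deriv V'),
      is_symbol (Phi N hN psi phi) D' /\ lifts p D' v') ->
  forall q1 q2 : usec A (preim (rm_cont p) V),
  exists q3 : usec A (preim (rm_cont p) V),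
    forall x (N : opens X) (hN : N `<=` p @^-1` V) (psi phi : lie_diffop A N),
    N x -> urep q1 x psi -> urep q2 x phi -> urep q3 x (Phi N hN psi phi).
Proof.
move=> Phi_agree Phi_lifts q1 q2.
pose P x (N : opens X) (psi3 : lie_diffop A N) :=
  N x /\ exists (hN : N `<=` p @^-1` V) (psi phi : lie_diffop A N),
    [/\ urep q1 x psi, urep q2 x phi & psi3 = Phi N hN psi phi].
have [x Ux|x N psi []//|x N N' psi psi' Ux|q3 q3E] := 
    @usec_ex (preim (rm_cont p) V) P.
- have [N [psi [D [W [v [Nx NW psiD Dv qpsi]]]]]] := usec_chart q1 Ux.
  have [N' [phi [E [W' [w [N'x N'W' phiE Ew qphi]]]]]] := usec_chart q2 Ux.
  pose M := opensI N N'; pose V' := opensI (opensI W W') V.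
  have MN : M `<=` N := @opensIl _ _ _.
  have MN' : M `<=` N' := @opensIr _ _ _.
  have V'W : V' `<=` W by move=> y [[]].
  have V'W' : V' `<=` W' by move=> y [[]].
  have hM : M `<=` p @^-1` V := subset_trans MN NW.
  have MV' : M `<=` p @^-1` V'.
    move=> y [Ny N'y]; split; last exact: NW.
    by split; [case: Dv => + _; exact|case: Ew => + _; exact].
  have [D' [v' [PhiD' Dv']]] := Phi_lifts M hM _ _ _ _ _ _ _ (@opensIr _ _ _)
    (is_symbol_restr MN psiD) (is_symbol_restr MN' phiE)
    (lifts_restr MN V'W MV' Dv) (lifts_restr MN' V'W' MV' Ew).
  exists M, (Phi M hM (ld_restr MN psi) (ld_restr MN' phi)), D', V', v'.
  split=> // y My; split=> //.
  exists hM, (ld_restr MN psi), (ld_restr MN' phi); split=> //.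
    by apply: urep_restr => //; apply: qpsi; exact: (MN y My).
  by apply: urep_restr => //; apply: qphi; exact: (MN' y My).
- move=> [Nx [hN [psi1 [phi1 [q1psi q2phi ->]]]]].
  move=> [N'x [hN' [psi2 [phi2 [q1psi' q2phi' ->]]]]].
  have [M [h [h' [Mx psiE]]]] := urep_agree q1psi q1psi'.
  have [M' [k [k' [M'x phiE]]]] := urep_agree q2phi q2phi'.
  pose M0 := opensI M M'.
  have l : M0 `<=` M := @opensIl _ _ _.
  have l' : M0 `<=` M' := @opensIr _ _ _.
  exists M0, (subset_trans l h), (subset_trans l h'); split=> //=.
  exact: (Phi_agree _ _ _ _ _ _ _ _ _ _ _ l l' _ _ _ _ _ _ psiE phiE).
exists q3 => x N hN psi phi Nx q1psi q2phi; apply: q3E.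
  by have := urep_mem q1psi.
by split=> //; exists hN, psi, phi.
Qed.

End Sections.

(** * The direct image of u(A) *)

Section DirectImage.
Variables (R : realType) (X S : ringedSpace R) (p : rsMorphism X S).
Variable A : lie_family p.

Definition upush (V : opens S) : Type := usec A (preim (rm_cont p) V).

Section Operations.
Variable V : opens S.
Implicit Types q r s : upush V.

Lemma ulin_ex (g : rs_fun V) q r : exists s,
  forall x (N : opens X) (hN : N `<=` p @^-1` V) (psi phi : lie_diffop A N),
    N x -> urep q x psi -> urep r x phi -> urep s x (ld_lin hN g psi phi).
Proof.
apply: (@usec_op2_ex _ _ _ _ _ _ (fun N hN => @ld_lin _ _ _ _ A N V hN g)).
  move=> U U' N N' M hU hU' h h' k k' l l' m m' psi phi psi' phi' psiE phiE.
  exact: (op_agree_lin hU hU' g l l' m m' psiE phiE).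
move=> N hN psi phi D E V' v w V'V psiD phiE Dv Ew.
exists (der_lin (pull hN g) D E), (der_lin (rs_res V'V g) v w).
by split; [exact: is_symbol_lin|exact: lifts_lin].
Qed.

(** The choice is immaterial: by [usec_eq], a section is determined by one representative at each
    point. *)
Definition ulin (g : rs_fun V) q r : upush V := projT1 (cid (ulin_ex g q r)).

Lemma urep_lin (g : rs_fun V) q r x (N : opens X) (hN : N `<=` p @^-1` V)
    (psi phi : lie_diffop A N) :
  N x -> urep q x psi -> urep r x phi ->
  urep (ulin g q r) x (ld_lin hN g psi phi).
Proof. by rewrite /ulin; case: cid => s /= sE; exact: sE. Qed.

Lemma ubracket_ex q r : exists s,
  forall x (N : opens X) (hN : N `<=` p @^-1` V) (psi phi : lie_diffop A N),
    N x -> urep q x psi -> urep r x phi -> urep s x (ld_comm psi phi).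
Proof.
apply: (@usec_op2_ex _ _ _ _ _ _ (fun N hN => @ld_comm _ _ _ _ A N)).
  move=> U U' N N' M hU hU' h h' k k' l l' m m' psi phi psi' phi' psiE phiE.
  exact: (op_agree_comm l l' m m' psiE phiE).
move=> N hN psi phi D E V' v w V'V psiD phiE Dv Ew.
exists (der_comm D E), (der_comm v w).
by split; [exact: is_symbol_comm|exact: lifts_comm].
Qed.

Definition ubracket q r : upush V := projT1 (cid (ubracket_ex q r)).

Lemma urep_bracket q r x (N : opens X) (hN : N `<=` p @^-1` V)
    (psi phi : lie_diffop A N) :
  N x -> urep q x psi -> urep r x phi ->
  urep (ubracket q r) x (ld_comm psi phi).
Proof. by rewrite /ubracket; case: cid => s /= sE; exact: sE. Qed.

Lemma uzero_ex : exists q, forall x (N : opens X),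
  N `<=` p @^-1` V -> N x -> urep q x (ld_zero A N).
Proof.
have [x Vx|x N psi []//|x N N' psi psi' Vx|q qE] :=
    @usec_ex _ _ _ _ A (preim (rm_cont p) V)
      (fun x N psi => N x /\ psi = ld_zero A N).
- exists (preim (rm_cont p) V), (ld_zero A _), (der_zero _), V, (der_zero _).
  split=> //; first exact: is_symbol_zero.
  exact: lifts_zero.
- move=> [Nx ->] [N'x ->].
  exists (opensI N N'), (@opensIl _ _ _), (@opensIr _ _ _); split=> //=.
  have [al zE] := op_agree_refl (@subset_refl _ _) (@subset_refl _ _)
    (ld_zero A (opensI N N')).
  by exists al => W k kV kV' s; exact: (zE W k k k).
by exists q => x N NV Nx; apply: qE => //; exact: NV.
Qed.

Definition uzero : upush V := projT1 (cid uzero_ex).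

Lemma urep_zero x (N : opens X) :
  N `<=` p @^-1` V -> N x -> urep uzero x (ld_zero A N).
Proof. by rewrite /uzero; case: cid => s /= sE; exact: sE. Qed.

Lemma urep3_ex q r s x : preim (rm_cont p) V x ->
  exists (N : opens X) (hN : N `<=` p @^-1` V) (psi phi chi : lie_diffop A N),
    [/\ N x, urep q x psi, urep r x phi & urep s x chi].
Proof.
move=> Vx; have [N1 [psi [_ [_ [_ [N1x N1V _ _ qpsi]]]]]] := usec_chart q Vx.
have [N2 [phi [_ [_ [_ [N2x _ _ _ rphi]]]]]] := usec_chart r Vx.
have [N3 [chi [_ [_ [_ [N3x _ _ _ schi]]]]]] := usec_chart s Vx.
pose N := opensI N1 (opensI N2 N3).
have h1 : N `<=` N1 by move=> y [].
have h2 : N `<=` N2 by move=> y [_ []].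
have h3 : N `<=` N3 by move=> y [_ []].
exists N, (subset_trans h1 N1V), (ld_restr h1 psi), (ld_restr h2 phi),
  (ld_restr h3 chi).
by split=> //; apply: urep_restr => //; auto.
Qed.

(** Reduces an identity in at most three sections to one between operators on a common domain. Exact
    equality of operators is asked, which is enough because the algebraic identities hold before
    passing to the quotient. *)
Lemma upush_eq3 (q1 q2 q3 q r : upush V) :
  (forall x (N : opens X) (hN : N `<=` p @^-1` V)
      (psi1 psi2 psi3 : lie_diffop A N), N x ->
    urep q1 x psi1 -> urep q2 x psi2 -> urep q3 x psi3 ->
    exists phi phi' : lie_diffop A N, [/\ urep q x phi, urep r x phi'
      & forall (W : opens X) (k : W `<=` N) (s : A W),
        phi W k s = phi' W k s]) ->
  q = r.
Proof.
move=> qr; apply: usec_eq => x Vx.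
have [N [hN [psi1 [psi2 [psi3 [Nx q1psi q2psi q3psi]]]]]] :=
  urep3_ex q1 q2 q3 Vx.
have [phi [phi' [qphi rphi /lie_diffop_eq phiE]]] :=
  qr x N hN _ _ _ Nx q1psi q2psi q3psi.
by exists N, phi; split=> //; rewrite phiE.
Qed.

(** The operators representing the two sides are left as existential variables and built by the
    representation lemmas from the shape of each side. *)
Ltac upush_eq3 a b c :=
  let hN := fresh "hN" in let Nx := fresh "Nx" in
  apply: (upush_eq3 (q1 := a) (q2 := b) (q3 := c)) =>
    x N hN psi1 psi2 psi3 Nx q1psi q2psi q3psi;
  do 2!eexists; split;
  [by repeat (exact: (urep_zero hN Nx) || eassumption ||
              apply: (urep_lin _ hN) => //)
  |by repeat (exact: (urep_zero hN Nx) || eassumption ||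
              apply: (urep_lin _ hN) => //)
  |move=> W k t /=].

Fact uaddA : associative (ulin 1).
Proof.
by move=> q r s; upush_eq3 q r s; rewrite /pull !rmorph1 !scale1r addrA.
Qed.

Fact uaddC : commutative (ulin 1).
Proof.
by move=> q r; upush_eq3 q r r; rewrite /pull !rmorph1 !scale1r addrC.
Qed.

Fact uadd0 : left_id uzero (ulin 1).
Proof. by move=> q; upush_eq3 q q q; rewrite scaler0 add0r. Qed.

Fact uaddN : left_inverse uzero (fun q => ulin (-1) q uzero) (ulin 1).
Proof.
move=> q; upush_eq3 q q q.
by rewrite /pull !rmorphN !rmorph1 scale1r scaleN1r addr0 addNr.
Qed.

Definition uscale (g : rs_fun V) q : upush V := ulin g q uzero.

Fact uscaleA (f g : rs_fun V) q : uscale f (uscale g q) = uscale (f * g) q.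
Proof. by upush_eq3 q q q; rewrite /pull !rmorphM !addr0 scalerA. Qed.

Fact uscale1 : left_id 1 uscale.
Proof. by move=> q; upush_eq3 q q q; rewrite /pull !rmorph1 addr0 scale1r. Qed.

Fact uscaleDr : right_distributive uscale (ulin 1).
Proof.
move=> g q r; upush_eq3 q r r.
by rewrite /pull !rmorph1 !addr0 !scale1r scalerDr.
Qed.

Fact uscaleDl q : {morph uscale^~ q : f g / f + g >-> ulin 1 f g}.
Proof.
move=> f g; upush_eq3 q q q.
by rewrite /pull !rmorphD !rmorph1 !addr0 !scale1r scalerDl.
Qed.

HB.instance Definition _ := gen_eqMixin (upush V).
HB.instance Definition _ := gen_choiceMixin (upush V).
HB.instance Definition _ :=
  GRing.isZmodule.Build (upush V) uaddA uaddC uadd0 uaddN.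
HB.instance Definition _ := GRing.Zmodule_isLmodule.Build (rs_fun V) (upush V)
  uscaleA uscale1 uscaleDr uscaleDl.

End Operations.
End DirectImage.

(** * Restriction and gluing of sections of the direct image *)

Section DirectImageSheaf.
Variables (R : realType) (X S : ringedSpace R) (p : rsMorphism X S).
Variable A : lie_family p.

Lemma urep_dom (U : opens X) (q : usec A U) x (N : opens X)
  (psi : lie_diffop A N) : urep q x psi -> N x.
Proof.
move=> qpsi; move: (qpsi).
by rewrite /urep (urep_germ qpsi) => -[M [h [h' []]]] /= /h'.
Qed.

Lemma preimS (V W : opens S) : V `<=` W ->
  preim (rm_cont p) V `<=` preim (rm_cont p) W.
Proof. by move=> VW x /VW. Qed.

Definition ures (V W : opens S) (h : V `<=` W) (q : upush A W) : upush A V :=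
  projT1 (cid (usec_res_ex (preimS h) q)).

Lemma urep_res (V W : opens S) (h : V `<=` W) (q : upush A W) x
    (N : opens X) (psi : lie_diffop A N) :
  V (p x) -> urep q x psi -> urep (ures h q) x psi.
Proof.
rewrite /ures; case: cid => r /= rE Vx qpsi; apply: rE => //.
exact: urep_dom qpsi.
Qed.

Lemma ures_germ (V W : opens S) (h : V `<=` W) (q : upush A W) x :
  V (p x) -> ii_germ (sval (ures h q)) x = ii_germ (sval q) x.
Proof.
move=> Vx; have [N [psi [_ [_ [_ [Nx _ _ _ /(_ _ Nx) qpsi]]]]]] :=
  @usec_chart _ _ _ _ _ (preim (rm_cont p) W) q x (h _ Vx).
by rewrite (urep_germ qpsi) (urep_germ (urep_res h Vx qpsi)).
Qed.

Lemma upush_eq (V : opens S) (q r : upush A V) :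
  (forall x, V (p x) -> ii_germ (sval q) x = ii_germ (sval r) x) -> q = r.
Proof.
move=> qr; apply: usec_eq => x Vx.
have [N [psi [_ [_ [_ [Nx _ _ _ /(_ _ Nx) qpsi]]]]]] := usec_chart q Vx.
by exists N, psi; split=> //; rewrite /urep -qr.
Qed.

(** Sections are functions with values in germs: the glued section takes at [x] the germ of any
    [s i] with [p x] in [V i], and compatibility on the intersection of [V i] and [V j] makes this
    independent of [i]. *)
Lemma ures_sheaf : is_sheaf (F := fun V => upush A V) ures.
Proof.
split.
- by move=> U h q; apply: upush_eq => x Ux; rewrite ures_germ.
- move=> U V W h k l q; apply: upush_eq => x Ux.
  by rewrite !ures_germ//; exact: h.
move=> U I V h UV s s_compat.
pose P x (N : opens X) (psi : lie_diffop A N) :=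
  exists i, V i (p x) /\ urep (s i) x psi.
have [x Ux|x N psi [i [_ /urep_dom]]//|x N N' psi psi' Ux|t tE] :=
    @usec_ex _ _ _ _ A (preim (rm_cont p) U) P.
- have [i _ Vx] := UV _ Ux.
  have [N [psi [D [M [v [Nx NV psiD Dv spsi]]]]]] :=
    @usec_chart _ _ _ _ _ (preim (rm_cont p) (V i)) (s i) x Vx.
  exists N, psi, D, M, v; split=> //; first by move=> y /NV /h.
  by move=> y Ny; exists i; split; [exact: NV|exact: spsi].
- move=> [i [Vi si]] [j [Vj sj]].
  have Wx : opensI (V i) (V j) (p x) by [].
  have := s_compat i j _ (@opensIl _ _ _) (@opensIr _ _ _).
  move=> /(congr1 (fun r : upush A _ => ii_germ (sval r) x)).
  by rewrite !ures_germ// (urep_germ si) => ->.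
have tV i : ures (h i) t = s i.
  apply: upush_eq => x Vx; rewrite ures_germ//.
  have [N [psi [_ [_ [_ [Nx _ _ _ /(_ _ Nx) spsi]]]]]] :=
    @usec_chart _ _ _ _ _ (preim (rm_cont p) (V i)) (s i) x Vx.
  have tpsi : urep t x psi by apply: tE; [exact: h Vx|exists i].
  by rewrite (urep_germ tpsi) (urep_germ spsi).
exists t; split=> // t' t'V; apply: upush_eq => x Ux.
have [i _ Vx] := UV _ Ux.
by rewrite -(ures_germ (h i))// tV -t'V ures_germ.
Qed.

Lemma ures_lin (V W : opens S) (h : V `<=` W) (g : rs_fun W) (q r : upush A W) :
  ures h (ulin g q r) = ulin (rs_res h g) (ures h q) (ures h r).
Proof.
apply: usec_eq => x Vx.
have [N [hN [psi [phi [_ [Nx qpsi rphi _]]]]]] :=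
  urep3_ex q r r (preimS h Vx).
pose M := opensI N (preim (rm_cont p) V).
have MN : M `<=` N := @opensIl _ _ _.
have hM : M `<=` p @^-1` V := @opensIr _ _ _.
have Mx : M x by [].
have {}qpsi := urep_restr MN Mx qpsi; have {}rphi := urep_restr MN Mx rphi.
exists M, (ld_lin hM (rs_res h g) (ld_restr MN psi) (ld_restr MN phi)).
split; last by apply: urep_lin => //; exact: urep_res.
apply: urep_res => //.
have -> : ld_lin hM (rs_res h g) (ld_restr MN psi) (ld_restr MN phi) =
    ld_lin (subset_trans MN hN) g (ld_restr MN psi) (ld_restr MN phi).
  apply: lie_diffop_eq => W' k s /=.
  by rewrite (pull_res _ _ (subset_trans k (subset_trans MN hN))).
exact: urep_lin.
Qed.

Lemma ures_zero (V W : opens S) (h : V `<=` W) :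
  ures h (0 : upush A W) = 0 :> upush A V.
Proof.
apply: usec_eq => x Vx; pose N := preim (rm_cont p) V.
have NV : N `<=` p @^-1` V by [].
exists N, (ld_zero A N); split; last exact: urep_zero.
by apply: urep_res => //; apply: urep_zero => // y /h.
Qed.

Fact ures_add (V W : opens S) (h : V `<=` W) (q r : upush A W) :
  ures h (q + r) = ures h q + ures h r.
Proof. by rewrite [LHS]ures_lin rmorph1. Qed.

Fact ures_scale (V W : opens S) (h : V `<=` W) (g : rs_fun W) (q : upush A W) :
  ures h (g *: q) = rs_res h g *: ures h q.
Proof. by rewrite [LHS]ures_lin ures_zero. Qed.

Definition upush_omodule : omodule S :=
  OModule ures_add ures_scale ures_sheaf.

Lemma urep_add (V : opens S) (q r : upush A V) x (N : opens X)
    (hN : N `<=` p @^-1` V) (psi phi : lie_diffop A N) :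
  urep q x psi -> urep r x phi -> urep (q + r) x (ld_lin hN 1 psi phi).
Proof. by move=> qpsi rphi; apply: urep_lin => //; exact: urep_dom qpsi. Qed.

Lemma urep_scale (V : opens S) (g : rs_fun V) (q : upush A V) x (N : opens X)
    (hN : N `<=` p @^-1` V) (psi : lie_diffop A N) :
  urep q x psi -> urep (g *: q) x (ld_lin hN g psi (ld_zero A N)).
Proof.
move=> qpsi; have Nx := urep_dom qpsi.
by apply: urep_lin => //; exact: urep_zero.
Qed.

End DirectImageSheaf.

(** * The Lie bracket on the direct image *)

Lemma addr_jacobi (V : zmodType) (a b c d e f : V) :
  a - b - (c - d) + (c - f - (e - b)) + (e - d - (a - f)) = 0.
Proof.
rewrite !opprB (AC ((2*2)*(2*2)*(2*2))
  ((1*12)*(7*2)*(3*10)*(5*4)*(11*6)*(9*8))) /=.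
by rewrite !subrr !addr0.
Qed.

Section BracketAxioms.
Variables (R : realType) (X S : ringedSpace R) (p : rsMorphism X S).
Variable A : lie_family p.

Lemma ures_bracket (V W : opens S) (h : V `<=` W) (q r : upush A W) :
  ures h (ubracket q r) = ubracket (ures h q) (ures h r).
Proof.
apply: usec_eq => x Vx.
have [N [hN [psi [phi [_ [Nx qpsi rphi _]]]]]] :=
  urep3_ex q r r (preimS h Vx).
pose M := opensI N (preim (rm_cont p) V).
have MN : M `<=` N := @opensIl _ _ _.
have hM : M `<=` p @^-1` V := @opensIr _ _ _.
have Mx : M x by [].
have {}qpsi := urep_restr MN Mx qpsi; have {}rphi := urep_restr MN Mx rphi.
exists M, (ld_comm (ld_restr MN psi) (ld_restr MN phi)); split.
  apply: urep_res => //; apply: urep_bracket => //.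
  exact: subset_trans MN hN.
by apply: urep_bracket => //; exact: urep_res.
Qed.

Variable V : opens S.
Implicit Types q r s : upush A V.

Lemma ubracket_bilinear_l (c : CC R) q q' r :
  ubracket (rs_cst V c *: q + q') r =
  rs_cst V c *: ubracket q r + ubracket q' r.
Proof.
apply: (upush_eq3 (q1 := q) (q2 := q') (q3 := r)) =>
  x N hN psi psi' phi Nx qpsi q'psi rphi.
do 2!eexists; split.
- exact: (urep_bracket hN Nx (urep_add hN (urep_scale _ hN qpsi) q'psi) rphi).
- apply: (urep_add hN); last exact: (urep_bracket hN Nx q'psi rphi).
  by apply: (urep_scale _ hN); exact: (urep_bracket hN Nx qpsi rphi).
move=> W k s /=; rewrite /pull !rmorph1 !scale1r !addr0.
rewrite -!/(pull (subset_trans k hN) _) !pull_cst endoD endoZ_cst.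
by rewrite opprD addrACA -scalerBr.
Qed.

Lemma ubracket_antisym q r : ubracket q r = - ubracket r q.
Proof.
apply: (upush_eq3 (q1 := q) (q2 := r) (q3 := r)) =>
  x N hN psi phi _ Nx qpsi rphi _.
do 2!eexists; split; first exact: (urep_bracket hN Nx qpsi rphi).
  apply: (urep_lin _ hN) => //; last exact: urep_zero.
  exact: (urep_bracket hN Nx rphi qpsi).
move=> W k s /=; rewrite /pull !rmorphN !rmorph1.
by rewrite scaleN1r addr0 opprB.
Qed.

(** For fixed representatives this is the Jacobi identity of commutators of endomorphisms: the six
    letters of [addr_jacobi] are the six composites of three operators, each occurring with both
    signs. *)
Lemma ubracket_jacobi q r s :
  ubracket q (ubracket r s) + ubracket r (ubracket s q) +
  ubracket s (ubracket q r) = 0.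
Proof.
apply: (upush_eq3 (q1 := q) (q2 := r) (q3 := s)) =>
  x N hN psi phi chi Nx qpsi rphi schi.
do 2!eexists; split.
- have br (q1 q2 q3 : upush A V) (u1 u2 u3 : lie_diffop A N)
      (h1 : urep q1 x u1) (h2 : urep q2 x u2) (h3 : urep q3 x u3) :=
    urep_bracket hN Nx h1 (urep_bracket hN Nx h2 h3).
  exact: (urep_add hN (urep_add hN (br _ _ _ _ _ _ qpsi rphi schi)
    (br _ _ _ _ _ _ rphi schi qpsi)) (br _ _ _ _ _ _ schi qpsi rphi)).
- exact: urep_zero.
move=> W k t; rewrite /= /pull !rmorph1 !scale1r !endoD !endoN.
exact: addr_jacobi.
Qed.

End BracketAxioms.

(** * The anchor *)

Section Comparison.
Variables (R : realType) (X S : ringedSpace R) (p : rsMorphism X S).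
Variables (A : lie_family p) (V : opens S).

(** The relations [u_add] and [u_bracket] quantify over all triples of representatives on unrelated
    domains, whereas the operations are known on operators with a common domain. The inner
    derivation in the conclusion is the discrepancy between the given representative of [q3] and the
    computed one. *)
Lemma u_op2_of_urep
    (Phi : forall W : opens X, (A W -> A W) -> (A W -> A W) -> A W -> A W)
    (q1 q2 q3 : upush A V) :
  (forall x (N : opens X) (hN : N `<=` p @^-1` V) (psi phi : lie_diffop A N),
    N x -> urep q1 x psi -> urep q2 x phi ->
    exists2 chi : lie_diffop A N, urep q3 x chi
      & forall (W : opens X) (k : W `<=` N) (s : A W),
          chi W k s = Phi W (psi W k) (phi W k) s) ->
  u_op2 Phi q1 q2 q3.
Proof.
move=> q3P x Vx V1 V2 V3 psi1 psi2 psi3 q1psi q2psi q3psi.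
pose N := opensI (opensI V1 V2) (preim (rm_cont p) V).
have N1 : N `<=` V1 by move=> y [[]].
have N2 : N `<=` V2 by move=> y [[]].
have Nx : N x.
  by split=> //; split; [exact: urep_dom q1psi|exact: urep_dom q2psi].
have [chi q3chi chiE] := q3P x N (@opensIr _ _ _) _ _ Nx
  (urep_restr N1 Nx q1psi) (urep_restr N2 Nx q2psi).
have [M [M3 [MN [Mx [al psiE]]]]] := urep_agree q3psi q3chi.
exists M, al; split=> //; try by move=> y /MN; auto.
move=> W k k1 k2 k3 s.
rewrite (canRL (subrK _) (psiE W k k3 (subset_trans k MN) s)) chiE /= addrC.
by congr (Phi _ (psi1 W _) (psi2 W _) _ + _); exact: Prop_irrelevance.
Qed.

Lemma upush_add (q r : upush A V) : u_add q r (q + r).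
Proof.
apply: u_op2_of_urep => x N hN psi phi Nx qpsi rphi.
exists (ld_lin hN 1 psi phi); first exact: urep_add.
by move=> W k s; rewrite /= /pull !rmorph1 scale1r.
Qed.

Lemma upush_bracket (q r : upush A V) : u_bracket q r (ubracket q r).
Proof.
apply: u_op2_of_urep => x N hN psi phi Nx qpsi rphi.
by exists (ld_comm psi phi) => //; exact: (urep_bracket hN).
Qed.

Lemma upush_scale (g : rs_fun V) (q : upush A V) : u_scale g q (g *: q).
Proof.
move=> x Vx V1 V2 psi1 psi2 qpsi rpsi.
pose N := opensI V1 (preim (rm_cont p) V).
have N1 : N `<=` V1 := @opensIl _ _ _.
have hN : N `<=` p @^-1` V := @opensIr _ _ _.
have Nx : N x by split=> //; exact: urep_dom qpsi.
have rN := urep_scale g hN (urep_restr N1 Nx qpsi).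
have [M [M2 [MN [Mx [al psiE]]]]] := urep_agree rpsi rN.
exists M, al; split=> //; try by move=> y /MN[].
move=> W k k1 k2 h s.
rewrite (canRL (subrK _) (psiE W k k2 (subset_trans k MN) s)) /= addr0 addrC.
congr (_ *: psi1 W _ _ + _); last exact: Prop_irrelevance.
by congr (pull _ g); exact: Prop_irrelevance.
Qed.

End Comparison.

Section Anchor.
Variables (R : realType) (X S : ringedSpace R) (p : rsMorphism X S).
Variable A : lie_family p.
Hypotheses (hp : smooth p) (hA : faithful_sheaf A).
Hypothesis hT : pushforward_invT_iso p.

(** A change of representative alters the symbol by a vertical derivation, invisible on functions
    pulled back from S. *)
Lemma urep_projects (U : opens X) (q : usec A U) x (N N' : opens X)
    (psi : lie_diffop A N) (psi' : lie_diffop A N') (D : deriv N)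
    (D' : deriv N') (V : opens S) (v : deriv V) :
  urep q x psi -> urep q x psi' -> is_symbol psi D -> is_symbol psi' D' ->
  projects p x D v -> projects p x D' v.
Proof.
move=> qpsi qpsi' psiD psiD' [M [Mx MN MV Dv]].
have [M' [h [h' [M'x psiE]]]] := urep_agree qpsi qpsi'.
exists (opensI M M'); split=> //.
- by move=> y [_ /h'].
- by move=> y [/MV].
move=> W kN' P kV l g WM.
have WM' : W `<=` M' := subset_trans WM (@opensIr _ _ _).
rewrite -(op_agree_symbol hA psiE psiD psiD' WM' (subset_trans WM' h) kN').
by apply: Dv => y /WM[].
Qed.

(** Smoothness gives equality of germs at points of the image of [p] only; the uniqueness half of
    [hT] turns it into equality on [V], as [v] and [w] induce the same section [t] of p^-1 T_S. *)
Lemma deriv_eq_of_projects (V : opens S) (v w : deriv V) :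
  (forall x, V (p x) -> exists (N : opens X) (D : deriv N),
    projects p x D v /\ projects p x D w) -> v = w.
Proof.
move=> vw; pose P (x : X) (V' : opens S) (u : deriv V') :=
  V' (p x) /\ germ (@deriv_agree R S) (p x) v = germ (@deriv_agree R S) (p x) u.
have [x Vx|x V1 V2 u1 u2 _ [_ <-] [_ <-]//|t tE] :=
    @invimage_ex _ _ (@deriv_agree R S) _ p (preim (rm_cont p) V) P.
  by exists (preim (rm_cont p) V), V, v; split.
have [u [_ uE]] := hT t.
have <- : u = v by apply: uE => x Vx; apply: tE.
apply: uE => x Vx; apply: tE => //; split=> //.
by have [N [D [Dv Dw]]] := vw x Vx; exact: (projects_germ hp Dv Dw).
Qed.

Definition is_anchor (V : opens S) (q : upush A V) (v : deriv V) : Prop :=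
  forall x (N : opens X) (psi : lie_diffop A N) (D : deriv N),
    urep q x psi -> is_symbol psi D -> projects p x D v.

Lemma anchor_ex (V : opens S) (q : upush A V) : exists v, is_anchor q v.
Proof.
pose P (x : X) (V' : opens S) (v : deriv V') :=
  V' (p x) /\ exists (N : opens X) (psi : lie_diffop A N) (D : deriv N),
    [/\ urep q x psi, is_symbol psi D & projects p x D v].
have [x Vx|x V1 V2 u1 u2 _|w wE] :=
    @invimage_ex _ _ (@deriv_agree R S) _ p (preim (rm_cont p) V) P.
- have [N [psi [D [V' [v [Nx NV psiD Dv qpsi]]]]]] := usec_chart q Vx.
  exists N, V', v; split=> //; first by case: Dv.
  move=> y Ny; split; first by case: Dv => + _; exact.
  by exists N, psi, D; split=> //; [exact: qpsi|exact: lifts_projects Dv].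
- move=> [_ [N1 [psi1 [D1 [q1 psiD1 Dv1]]]]].
  move=> [_ [N2 [psi2 [D2 [q2 psiD2 Dv2]]]]].
  by apply: (projects_germ hp _ Dv2); exact: (urep_projects q1 q2 psiD1 psiD2).
have [v [vw _]] := hT w; exists v => x N psi D qpsi psiD.
have Vx := urep_mem qpsi.
have [N' [psi' [D' [V' [v' [N'x _ psiD' Dv' /(_ _ N'x) qpsi']]]]]] :=
  usec_chart q Vx.
have {}Dv' := lifts_projects N'x Dv'.
(* The chart carries its own field [v'], which has the germ of [v] at [p x]: the claim passes from
   [psi] to the chart operator, then from [v] to [v']. *)
apply: (urep_projects qpsi' qpsi psiD' psiD); apply: (projects_of_germ _ Dv').
have V'x : V' (p x) by case: Dv' => M [Mx _ MV _]; exact: (MV _ Mx).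
have Pv' : P x V' v' by split=> //; exists N', psi', D'; split.
rewrite -(wE _ _ _ Vx Pv') (vw _ Vx).
by apply: germ_self => //; exact: deriv_agree_refl.
Qed.

Definition uanchor (V : opens S) (q : upush A V) : deriv V :=
  projT1 (cid (anchor_ex q)).

Lemma uanchorP (V : opens S) (q : upush A V) : is_anchor q (uanchor q).
Proof. by rewrite /uanchor; case: cid. Qed.

(** One representative with a symbol at each point suffices, so the compatibilities of the anchor
    follow from those of symbols and their lifts. *)
Lemma uanchor_eq (V : opens S) (q : upush A V) (v : deriv V) :
  (forall x, V (p x) -> exists (N : opens X) (psi : lie_diffop A N)
    (D : deriv N), [/\ urep q x psi, is_symbol psi D & projects p x D v]) ->
  uanchor q = v.
Proof.
move=> qv; apply: deriv_eq_of_projects => x /qv[N [psi [D [qpsi psiD Dv]]]].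
by exists N, D; split=> //; exact: (uanchorP qpsi psiD).
Qed.

Lemma uanchor_chart (V : opens S) (q : upush A V) x : V (p x) ->
  exists (N : opens X) (psi : lie_diffop A N) (D : deriv N),
    [/\ N x, urep q x psi, is_symbol psi D & lifts p D (uanchor q)].
Proof.
move=> Vx; have [N [psi [D [V' [v [Nx _ psiD _ /(_ _ Nx) qpsi]]]]]] :=
  @usec_chart _ _ _ _ _ (preim (rm_cont p) V) q x Vx.
have [M [MN [Mx Dv]]] := projects_lifts (uanchorP qpsi psiD).
exists M, (ld_restr MN psi), (der_restr MN D); split=> //.
  exact: urep_restr.
exact: is_symbol_restr.
Qed.

Lemma uanchor_chart2 (V : opens S) (q r : upush A V) x : V (p x) ->
  exists (N : opens X) (psi phi : lie_diffop A N) (D E : deriv N),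
    [/\ N x, urep q x psi /\ urep r x phi, is_symbol psi D /\ is_symbol phi E,
      lifts p D (uanchor q) & lifts p E (uanchor r)].
Proof.
move=> Vx; have [N1 [psi [D [N1x qpsi psiD Dv]]]] := uanchor_chart q Vx.
have [N2 [phi [E [N2x rphi phiE Ew]]]] := uanchor_chart r Vx.
pose N := opensI N1 N2.
have h1 : N `<=` N1 := @opensIl _ _ _.
have h2 : N `<=` N2 := @opensIr _ _ _.
have NV : N `<=` p @^-1` V by case: Dv => + _; exact: subset_trans.
have restr_id (v : deriv V) : der_restr (@subset_refl _ V) v = v.
  apply: deriv_eq => W h g /=.
  by rewrite (Prop_irrelevance (subset_trans h _) h).
exists N, (ld_restr h1 psi), (ld_restr h2 phi), (der_restr h1 D),
  (der_restr h2 E); split=> //.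
- by split; exact: urep_restr.
- by split; exact: is_symbol_restr.
- by rewrite -[uanchor q]restr_id; exact: lifts_restr.
- by rewrite -[uanchor r]restr_id; exact: lifts_restr.
Qed.

Lemma uanchor_res (V W : opens S) (h : V `<=` W) (q : upush A W) :
  uanchor (ures h q) = der_restr h (uanchor q).
Proof.
apply: uanchor_eq => x Vx.
have [N [psi [D [Nx qpsi psiD Dv]]]] := uanchor_chart q (h _ Vx).
pose M := opensI N (preim (rm_cont p) V).
have MN : M `<=` N := @opensIl _ _ _.
have MV : M `<=` p @^-1` V := @opensIr _ _ _.
have Mx : M x by [].
exists M, (ld_restr MN psi), (der_restr MN D); split.
- by apply: urep_res => //; exact: urep_restr.
- exact: is_symbol_restr.
- by apply: lifts_projects => //; exact: lifts_restr.
Qed.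

Lemma uanchor_linear (V : opens S) (g : rs_fun V) (q r : upush A V) :
  uanchor (g *: q + r) = der_lin g (uanchor q) (uanchor r).
Proof.
apply: uanchor_eq => x Vx.
have [N [psi [phi [D [E [Nx [qpsi rphi] [psiD phiE] Dv Ew]]]]]] :=
  uanchor_chart2 q r Vx.
have hN : N `<=` p @^-1` V by case: Dv.
exists N, (ld_lin hN g psi phi), (der_lin (pull hN g) D E); split.
- have -> : ld_lin hN g psi phi =
      ld_lin hN 1 (ld_lin hN g psi (ld_zero A N)) phi.
    by apply: lie_diffop_eq => W k s; rewrite /= /pull !rmorph1 scale1r addr0.
  by apply: urep_add => //; exact: urep_scale.
- exact: is_symbol_lin.
- have := lifts_lin hN (@subset_refl _ V) g Dv Ew.
  by rewrite rs_res_id; exact: lifts_projects.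
Qed.

Lemma ubracket_leibniz (V : opens S) (k : V `<=` V) (g : rs_fun V)
    (q r : upush A V) :
  ubracket (g *: q) r = g *: ubracket q r - uanchor r V k g *: q.
Proof.
apply: usec_eq => x Vx.
have [N [psi [phi [D [E [Nx [qpsi rphi] [psiD phiE] [hN Dv] [_ Ew]]]]]]] :=
  uanchor_chart2 q r Vx.
exists N, (ld_comm (ld_lin hN g psi (ld_zero A N)) phi); split.
  by apply: urep_bracket => //; exact: urep_scale.
(* The right-hand side on representatives, with the opposite spelled as multiplication by -1 so that
   it mirrors the module operations. *)
pose chi := ld_lin hN 1 (ld_lin hN g (ld_comm psi phi) (ld_zero A N))
  (ld_lin hN (-1) (ld_lin hN (uanchor r V k g) psi (ld_zero A N))
    (ld_zero A N)).
have -> : ld_comm (ld_lin hN g psi (ld_zero A N)) phi = chi.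
  apply: lie_diffop_eq => W l s; rewrite /= !addr0.
  have hW := subset_trans l hN.
  rewrite (Prop_irrelevance (subset_trans l hN) hW).
  (* The symbol [E] of [phi] differentiates the pull-back of [g]; since it lifts the anchor of [r],
     the result is again a pull-back from S. *)
  rewrite (canRL (subrK _) (phiE W l _ _)) (Ew _ _ _ k).
  have pull1 : pull hW 1 = 1 by rewrite /pull !rmorph1.
  have pullN1 : pull hW (-1) = -1 by rewrite /pull !rmorphN !rmorph1.
  rewrite pull1 pullN1 scale1r scaleN1r scalerBr opprD.
  by rewrite addrA addrAC.
apply: (urep_add hN).
  by apply: (urep_scale _ hN); exact: (urep_bracket hN).
by apply: (urep_lin _ hN) => //; [exact: (urep_scale _ hN)|exact: urep_zero].
Qed.

End Anchor.

(** * The Lie algebroid structure on the direct image *)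

Theorem proposition3p17 (R : realType) (X S : ringedSpace R)
    (p : rsMorphism X S) (A : lie_family p)
    (hX : complex_space X) (hS : complex_space S) (hp : smooth p)
    (hA : faithful_sheaf A) (hT : pushforward_invT_iso p) :
  exists (L : omodule S)
    (a : forall V : opens S, L V -> deriv V)
    (b : forall V : opens S, L V -> L V -> L V),
    lie_axioms a b /\
    exists iota : forall V : opens S, L V -> usec A (preim (rm_cont p) V),
      pushforward_u_iso a b iota.
Proof.
exists (upush_omodule A), (fun V q => uanchor hp hA hT q),
  (fun V q r => ubracket q r); split.
  have bilinear_l (V : opens S) (c : CC R) (q q' r : upush A V) :=
    ubracket_bilinear_l c q q' r.
  split=> /=.
  - by move=> U V h q W k l g; rewrite uanchor_res /=;
      congr (der _ _ g); exact: Prop_irrelevance.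
  - by move=> U f q r W k g; rewrite uanchor_linear.
  - by move=> U V h q r; exact: ures_bracket.
  - by move=> U c q q' r; exact: bilinear_l.
  (* Linearity on the right follows from linearity on the left by antisymmetry. *)
  - move=> U c q r r'; rewrite ubracket_antisym bilinear_l opprD -scalerN.
    by rewrite -!ubracket_antisym.
  - by move=> U q r; exact: ubracket_antisym.
  - by move=> U q r s; exact: ubracket_jacobi.
  - by move=> U k g q r; exact: ubracket_leibniz.
(* The sections of L over [V] are by construction those of u(A) over the preimage, so the
   isomorphism is the identity. *)
exists (fun V q => q); split.
- by move=> V; exists id.
- by move=> V W h q x Vx; exact: ures_germ.
- by move=> V q r; exact: upush_add.
- by move=> V g q; exact: upush_scale.
- by move=> V q r; exact: upush_bracket.
(* The value of [w] at [x] is the germ of the anchor at [p x], and projection of a symbol depends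
   only on that germ. *)
- move=> V q w aw x Vx N psi D V' v qpsi psiD; rewrite (aw _ Vx) => av.
  exact: projects_of_germ av (uanchorP hp hA hT qpsi psiD).
Qed.
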